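(* Let $\mathcal H$ be a real Hilbert space, let $V$ be a closed vector subspace of $\mathcal H$, let $f\in\Gamma_0(\mathcal H)$, let $\beta\in\,]0,+\infty[$, and let $g\colon\mathcal H\to\mathbb R$ be a differentiable convex function such that $\nabla g$ is $\beta^{-1}$-Lipschitzian. Let $\gamma\in\,]0,2\beta[$, let $\alpha=\max\{2/3,\,2\gamma/(\gamma+2\beta)\}$, let $(\lambda_n)_{n\in\mathbb N}$ be a sequence in $]0,1/\alpha[$, let $(a_n)_{n\in\mathbb N}$ and $(b_n)_{n\in\mathbb N}$ be sequences in $\mathcal H$, and suppose that $$\sum_{n\in\mathbb N}\lambda_n(1-\alpha\lambda_n)=+\infty\quad\text{and}\quad\sum_{n\in\mathbb N}\lambda_n(\|a_n\|+\|b_n\|)<+\infty$$ and that $$\operatorname{zer}(\partial f+\nabla g+N_V)\neq\varnothing.$$ Let $z_0\in\mathcal H$ and, for every $n\in\mathbb N$, set $$\begin{aligned}x_n&=P_Vz_n,\\ y_n&=(x_n-z_n)/\gamma,\\ s_n&=x_n-\gamma P_V(\nabla g(x_n)+a_n)+\gamma y_n,\\ p_n&=\operatorname{prox}_{\gamma f}s_n+b_n,\\ z_{n+1}&=z_n+\lambda_n(p_n-x_n).\end{aligned}$$ Then the sequences $(x_n)_{n\in\mathbb N}$ and $(y_n)_{n\in\mathbb N}$ are in $V$ and $V^\bot$, respectively, and there exist a solution $\overline x$ to the problem of minimizing $f(x)+g(x)$ over $x\in V$ and some $\overline y\in V^\bot\cap(\partial f(\overline x)+P_V\nabla g(\overline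 x))$ such that the following hold. (i) $x_n\rightharpoonup\overline x$ and $y_n\rightharpoonup\overline y$. (ii) $x_{n+1}-x_n\to0$ and $y_{n+1}-y_n\to0$. (iii) $\sum_{n\in\mathbb N}\lambda_n\|P_V(\nabla g(x_n)-\nabla g(\overline x))\|^2<+\infty$.
   Context: $\Gamma_0(\mathcal H)$ is the class of lower semicontinuous convex functions $f\colon\mathcal H\to\,]-\infty,+\infty]$ with $\operatorname{dom}f=\{x\mid f(x)<+\infty\}\neq\varnothing$. $\partial f(x)=\{u\in\mathcal H\mid(\forall y\in\mathcal H)\ \langle y-x\mid u\rangle+f(x)\le f(y)\}$ is the subdifferential; $\operatorname{prox}_fz$ is the unique minimizer of $f+\|\cdot-z\|^2/2$. $P_V$ is the orthogonal projection onto $V$, $V^\bot$ the orthogonal complement, and $N_V$ the normal cone operator: $N_Vx=V^\bot$ if $x\in V$, $N_Vx=\varnothing$ otherwise. For a set-valued operator $M$, $\operatorname{zer}M=\{x\mid0\in Mx\}$. $\rightharpoonup$ and $\to$ denote weak and strong convergence, respectively. *)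

(* Defs.v *)
From HB Require Import structures.
From mathcomp Require Import all_boot all_order all_algebra sesquilinear.
From mathcomp Require Import all_classical all_reals all_analysis.

Set Implicit Arguments.
Unset Strict Implicit.
Unset Printing Implicit Defensive.

Import Order.TTheory GRing.Theory Num.Theory.
Import numFieldNormedType.Exports.

Local Open Scope classical_set_scope.
Local Open Scope ring_scope.

(* A real Hilbert space is a complete normed module whose norm comes from an
   inner product.  For [theta := idfun], [Dot] is a symmetric positive definite
   bilinear form. *)
HB.mixin Record CompleteNormedModule_isHilbert (R : realType) H
    & CompleteNormedModule R H := {
  inner : {dot H for @idfun R} ;
  inner_norm : forall x : H, inner x x = `|x| ^+ 2
}.

#[short(type="hilbertType")]
HB.structure Definition Hilbert (R : realType) :=
  {H of CompleteNormedModule_isHilbert R H & CompleteNormedModule R H}.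

Section HilbertDefs.
Context {R : realType} {H : hilbertType R}.
Implicit Types (V A : set H) (x z u : H) (M N : H -> set H).

Definition closed_subspace V := GRing.submod_closed [in V] /\ closed V.

Definition orthogonal_complement V : set H :=
  [set u | forall v, V v -> inner v u = 0].

Definition projection V x : H :=
  xget 0 [set p | V p /\ orthogonal_complement V (x - p)].

Definition normal_cone V x : set H :=
  [set u | V x /\ orthogonal_complement V u].

Definition zer M : set H := [set x | M x 0].

Definition op_add M N x : set H := [set u + v | u in M x & v in N x].

(* The Riesz representer of the Frechet differential, for [g] differentiable
   at [x]. *)
Definition gradient (g : H -> R) x : H :=
  xget 0 [set u | forall h, 'd g x h = inner h u].

Local Open Scope ereal_scope.

Definition Gamma0 (f : H -> \bar R) :=
  [/\ forall x, f x != -oo,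
      exists x, f x < +oo,
      lower_semicontinuous f &
      forall x y (t : R), (0 < t < 1)%R ->
        f (t *: x + (1 - t) *: y)%R <= t%:E * f x + (1 - t)%:E * f y].

Definition subdifferential (f : H -> \bar R) x : set H :=
  [set u | forall y, (inner (y - x) u)%:E + f x <= f y].

Definition argmin_over A (h : H -> \bar R) : set H :=
  [set x | A x /\ forall y, A y -> h x <= h y].

(* The minimizer exists and is unique when [f] is in [Gamma0]; [0] is only the
   default value of [xget]. *)
Definition prox (f : H -> \bar R) z : H :=
  xget 0%R (argmin_over setT (fun x => f x + (`|x - z| ^+ 2 / 2)%:E)).

Definition weakly_cvg (w : nat -> H) (l : H) :=
  forall u, (fun n => inner (w n) u) @ \oo --> inner l u.

End HilbertDefs.

(* Main.v *)
Require Import Defs.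
From mathcomp Require Import all_boot all_order all_algebra sesquilinear.
From mathcomp Require Import all_classical all_reals all_analysis.
From mathcomp Require Import ring lra.

Set Implicit Arguments.
Unset Strict Implicit.
Unset Printing Implicit Defensive.

Import Order.TTheory GRing.Theory Num.Theory.
Import numFieldNormedType.Exports.

Local Open Scope classical_set_scope.
Local Open Scope ring_scope.

(** Let [P] be the projection onto [V] and let [Q = P o grad g o P]. Writing
    [z_n = x_n - gamma y_n], the algorithm is the perturbed relaxation
    [z_(n+1) = z_n + lambda_n (U z_n + e_n)] of the single operator
      [U z = prox_(gamma f) (2 P z - z - gamma Q z) - P z],
    with [lambda_n |e_n|] summable. A zero [zb] of [U] yields
    [xbar = P zb] and [ybar = (xbar - zb) / gamma], because the optimality
    condition of the proximity operator says precisely that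
    [ybar - P (grad g xbar)] is a subgradient of [f] at [xbar]; conversely a zero
    of the sum of the three operators produces a zero of [U].

    Monotonicity of the subdifferential of [f], together with the interpolation
    inequality of Baillon and Haddad for [g] ([cocoercive_gradient]), gives for
    any two points, with [d = gamma (Q z - Q w)] and [b = beta / gamma],
      [2 <Uz - Uw, z - w> + (2 - 1/(2b)) |Uz - Uw|^2 + (1/(2b)) |2 b d + Uz - Uw|^2
       + 2 sigma <= 0],
    where [sigma >= 0] is the gap in the interpolation inequality
    ([residual_cocoercive_slack]). Since [1 / alpha <= 2 - 1/(2b)]
    ([relaxation_bound]), [- U] is cocoercive with exactly the constant that the
    relaxation parameters allow. Hence the distances to the zeros of [U] are
    quasi-decreasing, [|U z_n|] is quasi-decreasing and tends to 0, and an
    Opial-type argument ([opial]) gives weak convergence of [z_n] to a zero.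
    Weak cluster points are obtained along ultrafilters: a bounded sequence has
    a weak limit along each of them by the Riesz representation theorem.

    The summability of [lambda_n |d_n|^2], relative to the weak limit, is the
    delicate point. The terms [lambda_n |2 b d_n + U z_n|^2], [lambda_n sigma_n]
    and [lambda_n (1 / alpha - lambda_n) |U z_n|^2] are summable. If
    [gamma <> beta], the inequality [1 / alpha < 2 - 1/(2b)] is strict, so that
    [lambda_n |U z_n|^2] is summable too, and the claim follows. If
    [gamma = beta], the bound [1 / alpha = 3/2 = 2 - 1/(2b)] is attained and
    [lambda_n] may approach it; steps with [lambda_n < 1] are harmless, but the
    long ones need another argument. There [U z_n] is close to [- 2 d_n] and
    [sigma_n] is small, and then interpolation for [g] forces the drifts [d] and
    [d'] at the two ends of a long step to satisfy [<d, d'> <= 0] up to the small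
    terms. Monotonicity for [f] turns this into
    [|d'|^2 <= 3/4 |d|^2 + small terms] ([drift_contraction]). Consecutive long
    steps can be separated by many short ones; these either
    move the iterate little or have already paid for [|U z_n|^2]
    ([long_steps_summable]). *)

(** * Inner products *)

Section InnerProduct.
Context {R : realType} {H : hilbertType R}.
Implicit Types (x y z u v : H) (c : R).

(** The inner product with codomain literally [R], so that its values are atoms
    for the decision procedures of ordered fields. *)
Definition dot x y : R := inner x y.

Lemma inner_dotE x y : inner x y = dot x y.
Proof. by []. Qed.

Lemma dotC x y : dot x y = dot y x.
Proof. by rewrite /dot hermC expr0 mul1r. Qed.

Lemma dotDl x y z : dot (x + y) z = dot x z + dot y z.
Proof. by rewrite /dot linearDl. Qed.

Lemma dotDr x y z : dot z (x + y) = dot z x + dot z y.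
Proof. by rewrite ![dot z _]dotC dotDl. Qed.

Lemma dotZl c x z : dot (c *: x) z = c * dot x z.
Proof. by rewrite /dot linearZl_LR. Qed.

Lemma dotZr c x z : dot z (c *: x) = c * dot z x.
Proof. by rewrite ![dot z _]dotC dotZl. Qed.

Lemma dotNl x z : dot (- x) z = - dot x z.
Proof. by rewrite -scaleN1r dotZl mulN1r. Qed.

Lemma dotNr x z : dot z (- x) = - dot z x.
Proof. by rewrite ![dot z _]dotC dotNl. Qed.

Lemma dot0l z : dot 0 z = 0.
Proof. by rewrite -(scale0r z) dotZl mul0r. Qed.

Lemma dot0r z : dot z 0 = 0.
Proof. by rewrite dotC dot0l. Qed.

Definition dotE := (dotDl, dotDr, dotNl, dotNr, dotZl, dotZr).

Lemma dot_norm x : dot x x = `|x| ^+ 2.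
Proof. exact: inner_norm. Qed.

Lemma dot_ge0 x : 0 <= dot x x.
Proof. by rewrite dot_norm sqr_ge0. Qed.

Lemma dot_eq0 x : dot x x <= 0 -> x = 0.
Proof.
move=> xx0; apply/eqP; rewrite -normr_eq0 -sqrf_eq0 -dot_norm.
by rewrite eq_le xx0 dot_ge0.
Qed.

Lemma dot_ext x y : (forall t, dot x t = dot y t) -> x = y.
Proof.
move=> xy; apply/eqP; rewrite -subr_eq0; apply/eqP/dot_eq0.
by rewrite dotDl dotNl xy subrr.
Qed.

Lemma dot_add_le x y : dot (x + y) (x + y) <= 2 * (dot x x + dot y y).
Proof. by have := dot_ge0 (x - y); rewrite !dotE (dotC y x); lra. Qed.

Lemma dot_young c x y : 0 < c ->
  2 * `|dot x y| <= c * dot x x + c^-1 * dot y y.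
Proof.
move=> c0; have c0' : c != 0 by rewrite gt_eqF.
have expand s : c^-1 * dot (c *: x - s *: y) (c *: x - s *: y) =
    c * dot x x - 2 * s * dot x y + s ^+ 2 * (c^-1 * dot y y).
  by rewrite !dotE (dotC y x); field.
have pos s : 0 <= c^-1 * dot (c *: x - s *: y) (c *: x - s *: y).
  by rewrite mulr_ge0 ?dot_ge0// invr_ge0 ltW.
have := pos 1; have := pos (-1); rewrite !expand sqrrN expr1n.
by case: (ler0P (dot x y)) => _; lra.
Qed.

Lemma dot_cauchy_schwarz x y : `|dot x y| <= `|x| * `|y|.
Proof.
have [->|x0] := eqVneq x 0; first by rewrite dot0l !normr0 mul0r.
have [->|y0] := eqVneq y 0; first by rewrite dot0r !normr0 mulr0.
have nx : 0 < `|x| by rewrite normr_gt0.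
have ny : 0 < `|y| by rewrite normr_gt0.
have := @dot_young (`|y| / `|x|) x y (divr_gt0 ny nx).
rewrite !dot_norm.
suff -> : `|y| / `|x| * `|x| ^+ 2 + (`|y| / `|x|)^-1 * `|y| ^+ 2 =
  2 * (`|x| * `|y|) by lra.
by field; rewrite !gt_eqF.
Qed.

End InnerProduct.

(** Decides linear identities between vectors by testing them against an
    arbitrary vector, which turns them into ring identities. *)
Ltac vector_identity := apply: dot_ext => ?; rewrite !dotE; ring.

(** * Minimization of strongly convex functions *)

Section Minimization.
Context {R : realType} {H : hilbertType R}.

(** By uniform convexity at midpoints, two points whose values are within [e] of
    the infimum are at distance of order [sqrt e], so minimizing sequences are
    Cauchy. The projection, the Riesz representation and the proximity operator
    are all instances; the closedness assumption is lower semicontinuity of [h]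
    extended by [+oo] outside [D]. *)
Lemma midpoint_convex_minimizer (D : set H) (h : H -> R) (m : R) :
  D !=set0 ->
  (forall x y, D x -> D y -> D (2^-1 *: (x + y)) /\
     h (2^-1 *: (x + y)) <= (h x + h y) / 2 - dot (x - y) (x - y) / 8) ->
  (forall x, D x -> m <= h x) ->
  (forall r, closed [set x | D x /\ h x <= r]) ->
  exists2 c, D c & forall x, D x -> h c <= h x.
Proof.
move=> [x0 Dx0] hmid hm hcl.
pose E := h @` D; pose i := inf E.
have hE : has_inf E.
  by split; [exists (h x0), x0 | exists m => _ [x Dx <-]; exact: hm].
have ileE x : D x -> i <= h x by move=> Dx; apply: ge_inf; [case: hE|exists x].
have approx n : exists x, D x /\ h x <= i + n.+1%:R^-1.
  have [|_ [x Dx <-] hx] := @inf_adherent _ E n.+1%:R^-1 _ hE.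
    by rewrite invr_gt0 ltr0n.
  by exists x; split => //; rewrite ltW.
move: i ileE approx => {hE} i ileE approx.
have [u hu] := choice approx.
have near_u N n k : (N <= n)%N -> (N <= k)%N ->
    dot (u n - u k) (u n - u k) <= 8 * N.+1%:R^-1.
  move=> Nn Nk; have [Dn un] := hu n; have [Dk uk] := hu k.
  have [Dm um] := hmid _ _ Dn Dk; have im := ileE _ Dm.
  have ni : n.+1%:R^-1 <= N.+1%:R^-1 :> R by rewrite lef_pV2 ?posrE ?ltr0n// ler_nat.
  have ki : k.+1%:R^-1 <= N.+1%:R^-1 :> R by rewrite lef_pV2 ?posrE ?ltr0n// ler_nat.
  move: un uk um im ni ki.
  by move: (N.+1%:R^-1) (n.+1%:R^-1) (k.+1%:R^-1) => a b c; lra.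
have arch e : 0 < e -> exists N : nat, N.+1%:R^-1 < e :> R.
  move=> e0; have [N _ /(_ N (leqnn N)) hN] := near_infty_natSinv_lt (PosNum e0).
  by exists N.
have cu : cvg (u @ \oo).
  apply/cauchy_cvgP; apply: cauchy_exP => e e0.
  have [N hN] : exists N : nat, 8 * N.+1%:R^-1 < e ^+ 2.
    have e2 : 0 < e ^+ 2 / 8 by rewrite divr_gt0// exprn_gt0.
    have [N hN] := arch _ e2; exists N; move: hN; move: (N.+1%:R^-1) => t; lra.
  exists (u N); exists N => // n /= Nn.
  rewrite -ball_normE /ball_ /=.
  rewrite -(ltr_pXn2r (ltn0Sn 1)) ?nnegrE ?(ltW e0)//.
  by rewrite -dot_norm; exact: le_lt_trans (near_u N N n (leqnn N) Nn) hN.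
have limD N : D (lim (u @ \oo)) /\ h (lim (u @ \oo)) <= i + N.+1%:R^-1.
  suff near_n : \forall n \near \oo, [set x | D x /\ h x <= i + N.+1%:R^-1] (u n).
    exact: (closed_cvg _ (hcl _) near_n _ cu).
  exists N => // n /= Nn; have [Dn un] := hu n; split => //; apply: le_trans un _.
  by rewrite lerD2l lef_pV2 ?posrE ?ltr0n// ler_nat.
exists (lim (u @ \oo)); first by case: (limD 0%N).
move=> x Dx; apply: le_trans (ileE _ Dx).
apply/ler_addgt0Pr => e e0; have [N hN] := arch _ e0.
by apply: le_trans (limD N).2 _; rewrite lerD2l ltW.
Qed.

Lemma sqr_norm_midpoint (x y z : H) :
  dot (2^-1 *: (x + y) - z) (2^-1 *: (x + y) - z) / 2 =
  (dot (x - z) (x - z) / 2 + dot (y - z) (y - z) / 2) / 2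
  - dot (x - y) (x - y) / 8.
Proof.
by rewrite !dotE (dotC y x) (dotC z x) (dotC z y); field.
Qed.

Lemma sqr_norm_continuous (z : H) :
  continuous (fun x : H => dot (x - z) (x - z) / 2).
Proof.
move=> x; apply: cvgMl; under eq_fun do rewrite dot_norm expr2.
rewrite dot_norm expr2; apply: (@cvgM _ _ (nbhs x)).
  by apply: cvg_norm; apply: cvgB; [exact: cvg_id|exact: cvg_cst].
by apply: cvg_norm; apply: cvgB; [exact: cvg_id|exact: cvg_cst].
Qed.

(** A linear term dominates a quadratic one near 0: this extracts the
    first-order optimality conditions from minimality along a segment. *)
Lemma first_order_ge0 (q w : R) :
  (forall t, 0 < t < 1 -> 0 <= t * q + t ^+ 2 * w) -> 0 <= q.
Proof.
move=> hq; rewrite leNgt; apply/negP => q0.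
have ww : w <= `|w| := ler_norm w.
have W0 : 0 <= `|w| by [].
set W := `|w| in ww W0; set D := - q + W + 1.
have D0 : 0 < D by rewrite /D; lra.
have t0 : 0 < - q / D by apply: divr_gt0 => //; lra.
have t1 : - q / D < 1 by rewrite ltr_pdivrMr// /D; lra.
have := hq (- q / D); rewrite t0 t1 => /(_ isT).
set t := - q / D in t0 t1 *.
have tW : t * w <= t * W by rewrite ler_pM2l.
have tD : t * D = - q by rewrite /t mulfVK// gt_eqF.
have : t * (q + t * w) < 0.
  by rewrite pmulr_rlt0//; move: tD; rewrite /D => tD; nra.
by rewrite mulrDr expr2 mulrA; lra.
Qed.

Lemma first_order_eq0 (q w : R) :
  (forall t, 0 <= t * q + t ^+ 2 * w) -> q = 0.
Proof.
move=> hq; apply/eqP; rewrite eq_le; apply/andP; split.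
  rewrite -oppr_ge0; apply: (@first_order_ge0 _ w) => t _.
  by have := hq (- t); rewrite sqrrN; lra.
by apply: (@first_order_ge0 _ w) => t _; exact: hq.
Qed.

(** The representer is the minimizer of [|u|^2 / 2 - L u]. *)
Lemma riesz_representation (L : H -> R) (K : R) :
  (forall u v, L (u + v) = L u + L v) ->
  (forall c u, L (c *: u) = c * L u) ->
  (forall u, `|L u| <= K * `|u|) ->
  exists c, forall u, L u = dot c u.
Proof.
move=> LD LZ LK.
have LB u v : L (u - v) = L u - L v by rewrite -scaleN1r LD LZ mulN1r.
have Lc : continuous L.
  move=> x; apply/cvgrPdist_lt => e e0.
  have K1 : 0 < `|K| + 1 by rewrite ltr_wpDl.
  near=> t.
  have : `|x - t| < e / (`|K| + 1).
    by near: t; apply: cvgr_dist_lt; rewrite ?divr_gt0.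
  rewrite ltr_pdivlMr// => xt; rewrite -LB; apply: le_lt_trans xt.
  apply: le_trans (LK _) _; rewrite mulrC; apply: ler_wpM2l => //.
  by have := ler_norm K; lra.
pose h (u : H) := dot (u - 0) (u - 0) / 2 - L u.
have hc : continuous h.
  by move=> x; apply: cvgB; [exact: sqr_norm_continuous|exact: Lc].
have [||||c _ hmin] := @midpoint_convex_minimizer setT h (- (K ^+ 2 / 2)).
- by exists 0.
- move=> x y _ _; split => //.
  by rewrite /h sqr_norm_midpoint LZ LD; lra.
- move=> x _; rewrite /h subr0 dot_norm; have := LK x; have := ler_norm (L x).
  by have := sqr_ge0 (`|x| - K); rewrite sqrrB; lra.
- move=> r; rewrite [X in closed X](_ : _ = h @^-1` [set t | t <= r]).
    by apply: closed_comp => [? _|]; [exact: hc|exact: closed_le].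
  by apply/seteqP; split => x /=; tauto.
exists c => u; apply/esym/eqP; rewrite -subr_eq0; apply/eqP.
apply: (@first_order_eq0 _ (dot u u / 2)) => t.
have := hmin (c + t *: u) I.
by rewrite /h !subr0 LD LZ !dotE (dotC u c) expr2; lra.
Unshelve. all: by end_near. Qed.

End Minimization.

(** * Projections onto closed subspaces *)

Section Projection.
Context {R : realType} {H : hilbertType R} (V : set H).
Hypothesis hV : closed_subspace V.
Implicit Types (x y u v p : H) (c : R).

Lemma subspace0 : V 0.
Proof. by case: hV => -[+ _] _; rewrite inE. Qed.

Lemma subspace_linear c u v : V u -> V v -> V (c *: u + v).
Proof.
case: hV => -[_ Vlin] _ Vu Vv.
by have := Vlin c u v (mem_set Vu) (mem_set Vv); rewrite inE.
Qed.

Lemma subspaceD u v : V u -> V v -> V (u + v).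
Proof. by move=> Vu Vv; rewrite -(scale1r u); exact: subspace_linear. Qed.

Lemma subspaceZ c u : V u -> V (c *: u).
Proof.
by move=> Vu; rewrite -[_ *: _]addr0; apply: subspace_linear subspace0.
Qed.

Lemma subspaceB u v : V u -> V v -> V (u - v).
Proof.
by move=> Vu Vv; apply: subspaceD => //; rewrite -scaleN1r; exact: subspaceZ.
Qed.

Lemma projection_spec x :
  V (projection V x) /\ orthogonal_complement V (x - projection V x).
Proof.
rewrite /projection.
apply: (@xgetPex _ 0 [set p | V p /\ orthogonal_complement V (x - p)]).
pose h u := dot (u - x) (u - x) / 2.
have [||||p Vp hmin] := @midpoint_convex_minimizer R H V h 0.
- by exists 0; exact: subspace0.
- move=> u v Vu Vv; split; first by apply: subspaceZ; exact: subspaceD.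
  by rewrite /h sqr_norm_midpoint.
- by move=> u _; rewrite /h divr_ge0// dot_ge0.
- move=> r; apply: closedI; first by case: hV.
  rewrite -[X in closed X]/(h @^-1` [set t | t <= r]).
  by apply: closed_comp => [? _|]; [exact: sqr_norm_continuous|exact: closed_le].
exists p; split => // v Vv; rewrite -/(dot v (x - p)).
apply/eqP; rewrite -oppr_eq0; apply/eqP.
apply: (@first_order_eq0 _ _ (dot v v / 2)) => t.
have := hmin (p + t *: v); rewrite /h => /(_ _).
have Vpt : V (p + t *: v) by apply: subspaceD => //; exact: subspaceZ.
move=> /(_ Vpt); rewrite !dotE (dotC x p) (dotC v p) (dotC v x) expr2; lra.
Qed.

Lemma projection_in x : V (projection V x).
Proof. by case: (projection_spec x). Qed.

Lemma dot_projection v x : V v -> dot v (projection V x) = dot v x.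
Proof.
move=> Vv; have := (projection_spec x).2 v Vv; rewrite -/(dot _ _) !dotE; lra.
Qed.

Lemma dot_projectionl v x : V v -> dot (projection V x) v = dot x v.
Proof. by move=> Vv; rewrite dotC dot_projection// dotC. Qed.

Lemma dot_projectionC x y : dot (projection V x) y = dot x (projection V y).
Proof.
rewrite -(dot_projection _ (projection_in x)) dotC -[RHS]dotC.
by rewrite -(dot_projection x (projection_in y)).
Qed.

Lemma projection_unique x p :
  V p -> (forall v, V v -> dot v p = dot v x) -> projection V x = p.
Proof.
move=> Vp hp; apply/eqP; rewrite -subr_eq0; apply/eqP; apply: dot_eq0.
have orth v : V v -> dot v (projection V x - p) = 0.
  by move=> Vv; rewrite !dotE dot_projection// hp// subrr.
by rewrite orth//; apply: subspaceB => //; exact: projection_in.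
Qed.

Lemma projection_linear c x y :
  projection V (c *: x + y) = c *: projection V x + projection V y.
Proof.
apply: projection_unique => [|v Vv].
  by apply: subspace_linear; exact: projection_in.
by rewrite !dotE !dot_projection.
Qed.

Lemma projectionD x y : projection V (x + y) = projection V x + projection V y.
Proof. by have := projection_linear 1 x y; rewrite !scale1r. Qed.

Lemma projection_id x : V x -> projection V x = x.
Proof. by move=> Vx; exact: projection_unique. Qed.

Lemma projectionB x y : projection V (x - y) = projection V x - projection V y.
Proof. by rewrite -scaleN1r addrC projection_linear scaleN1r addrC. Qed.

Lemma dot_projectionid x :
  dot x (projection V x) = dot (projection V x) (projection V x).
Proof. by rewrite (dot_projection x (projection_in x)) dotC. Qed.

Lemma projection_pythagoras x : dot x x = dot (projection V x) (projection V x)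
  + dot (x - projection V x) (x - projection V x).
Proof. by rewrite !dotE (dotC _ x) dot_projectionid; lra. Qed.

Lemma projection_dot_le x : dot (projection V x) (projection V x) <= dot x x.
Proof. by rewrite [leRHS]projection_pythagoras lerDl dot_ge0. Qed.

Lemma projection_compl_dot_le x :
  dot (x - projection V x) (x - projection V x) <= dot x x.
Proof. by rewrite [leRHS]projection_pythagoras lerDr dot_ge0. Qed.

Lemma projection_norm_le x : `|projection V x| <= `|x|.
Proof.
rewrite -(@ler_pXn2r _ 2)// ?nnegrE// -!dot_norm.
exact: projection_dot_le.
Qed.

End Projection.

(** * Convex functions with a Lipschitz gradient *)

Section Gradient.
Context {R : realType} {H : hilbertType R} (g : H -> R).
Hypothesis dg : forall x, differentiable g x.
Implicit Types (x y u v d : H).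

(** Riesz representation makes the default value in [gradient] irrelevant. *)
Lemma gradient_spec x d : 'd g x d = dot (gradient g x) d.
Proof.
have [K K0 hK] := linear_lipschitz (diff_continuous (dg x)).
have [|c|u|c hc] := @riesz_representation R H ('d g x) K.
- by move=> u v; rewrite linearD.
- exact: linearZZ.
- exact: hK.
rewrite /gradient dotC.
apply: (@xgetPex _ 0 [set u | forall h, 'd g x h = inner h u]).
by exists c => h; rewrite hc dotC.
Qed.

Lemma is_derive_line x d (t : R) : is_derive t (1 : R) (fun r : R => g (x + r *: d))
  (dot (gradient g (x + t *: d)) d).
Proof.
have E : (fun h : R => h^-1 *: (((fun r : R => g (x + r *: d)) \o shift t) (h *: 1) -
   g (x + t *: d))) =
  (fun h : R => h^-1 *: ((g \o shift (x + t *: d)) (h *: d) - g (x + t *: d))).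
  apply/funext => h /=; congr (_ *: (g _ - _)).
  by rewrite [h *: 1]mulr1 scalerDl addrCA.
split.
  rewrite /derivable E.
  exact: diff_derivable.
by rewrite /derive E -/(derive _ _ _) deriveE// gradient_spec.
Qed.

Hypothesis cg : convex_function setT g.

Lemma convex_function_segment x y (t : R) : 0 <= t <= 1 ->
  g (t *: x + (1 - t) *: y) <= t * g x + (1 - t) * g y.
Proof.
case/andP => t0 t1.
have := cg (Itv01 t0 t1) (mem_set I) (mem_set I) => /(_ x y).
by [].
Qed.

Lemma convex_gradient_ineq x y : g x + dot (gradient g x) (y - x) <= g y.
Proof.
have [dl dE] := is_derive_line x (y - x) 0.
rewrite scale0r addr0 in dE.
suff : dot (gradient g x) (y - x) <= g y - g x by lra.
rewrite -dE /derive cvg_at_rightE; last exact: dl.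
apply: limr_le.
  by have /cvg_ex[l /cvg_dnbhs_at_right dl'] := dl; apply/cvg_ex; exists l.
near=> t.
have t0 : 0 < t by near: t; exact: nbhs_right_gt.
have t1 : t < 1 by near: t; exact: nbhs_right_lt.
have := @convex_function_segment y x t.
rewrite (ltW t0) (ltW t1) => /(_ isT) hc.
rewrite /= scale0r !addr0 [t *: 1]mulr1 -[X in X <= _]/(t^-1 * _) ler_pdivrMl//.
have <- : t *: y + (1 - t) *: x = x + t *: (y - x).
  by rewrite scalerBl scale1r scalerBr addrCA addrA.
by move: hc; lra.
Unshelve. all: by end_near. Qed.

(** The derivative of the difference of both sides along the segment from [x] to
    [y] has a sign, since the gradient moves by at most [L t |y - x|]. *)
Lemma descent_lemma (L : R) x y : 0 < L ->
  (forall u v, dot (gradient g u - gradient g v) (gradient g u - gradient g v)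
     <= L ^+ 2 * dot (u - v) (u - v)) ->
  g y <= g x + dot (gradient g x) (y - x) + L / 2 * dot (y - x) (y - x).
Proof.
move=> L0 lipg; set d := y - x.
pose psi (t : R) := g (x + t *: d) - t * dot (gradient g x) d
  - t ^+ 2 * (L / 2 * dot d d).
have dpsi (t : R) : is_derive t (1 : R) psi
    (dot (gradient g (x + t *: d)) d - dot (gradient g x) d - t * (L * dot d d)).
  have := is_derive_line x d t => dline.
  rewrite /psi; apply: is_derive_eq.
  move: (dot (gradient g (x + t *: d)) d) (dot (gradient g x) d) (dot d d) => p q r.
  by rewrite /GRing.scale /=; field.
have slope_le0 (t : R) : 0 < t -> dot (gradient g (x + t *: d)) d
    - dot (gradient g x) d - t * (L * dot d d) <= 0.
  move=> t0; have Lt0 : 0 < (L * t)^-1 by rewrite invr_gt0 mulr_gt0.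
  have := dot_young (gradient g (x + t *: d) - gradient g x) d Lt0.
  have := lipg (x + t *: d) x; rewrite [x + _ - _]addrC addKr invrK.
  have := ler_norm (dot (gradient g (x + t *: d) - gradient g x) d).
  rewrite dotDl dotNl dotZl dotZr.
  move: (dot (gradient g (x + t *: d)) d - dot (gradient g x) d) => p.
  move: (dot _ (gradient g (x + t *: d) - _)) (dot d d) => q r.
  move=> pp qr; have : (L * t)^-1 * q <= (L * t)^-1 * (L ^+ 2 * (t * (t * r))).
    by rewrite ler_pM2l.
  have -> : (L * t)^-1 * (L ^+ 2 * (t * (t * r))) = t * (L * r).
    by field; rewrite !gt_eqF.
  by clear - pp; lra.
have psi_nincr : psi 1 <= psi 0.
  have hd s : s \in `]0, 1[ -> derivable psi s 1 by move=> _; exact: ex_derive.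
  have hc : {within `[0, 1], continuous psi}.
    by apply: derivable_within_continuous => s _; exact: ex_derive.
  apply: (ler0_derive1_nincr hd _ hc) => // s.
  by rewrite in_itv /= => /andP[s0 _]; rewrite derive1E derive_val; exact: slope_le0.
move: psi_nincr; rewrite /psi scale1r scale0r addr0 [x + d]addrC subrK.
by move: (dot d d) (dot (gradient g x) d) => r q; clear; lra.
Qed.

(** Compare [g] at the point [w = x - (grad g x - grad g y) / L]: the tangent at
    [y] bounds [g w] from below and the descent lemma at [x] bounds it from above. *)
Lemma cocoercive_gradient (L : R) x y : 0 < L ->
  (forall u v, dot (gradient g u - gradient g v) (gradient g u - gradient g v)
     <= L ^+ 2 * dot (u - v) (u - v)) ->
  g y + dot (gradient g y) (x - y) + L^-1 / 2 *
    dot (gradient g x - gradient g y) (gradient g x - gradient g y) <= g x.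
Proof.
move=> L0 lipg; set e := gradient g x - gradient g y.
have ee : dot e e = dot (gradient g x) e - dot (gradient g y) e.
  by rewrite {1}/e dotDl dotNl.
move: (gradient g x) (gradient g y) e ee (convex_gradient_ineq y (x - L^-1 *: e))
  (@descent_lemma L x (x - L^-1 *: e) L0 lipg) => p q e ee.
have -> : x - L^-1 *: e - x = - (L^-1 *: e) by rewrite addrAC subrr add0r.
rewrite [_ - _ - y]addrAC dotNl !dotDr !dotNr opprK dotZl !dotZr ee.
move: (dot p e) (dot q e) => a b {ee}.
have -> : L / 2 * (L^-1 * (L^-1 * (a - b))) = L^-1 / 2 * (a - b).
  by field; rewrite gt_eqF.
move: (L^-1) => k; clear. lra.
Qed.

End Gradient.

(** * Subdifferentials and proximity operators *)

Section Subdifferential.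
Context {R : realType} {H : hilbertType R} (f : H -> \bar R).
Hypothesis hf : Gamma0 f.
Implicit Types (x y z u v p s : H) (c : R).

Lemma fin_numP_Gamma0 x : (f x \is a fin_num) = (f x < +oo)%E.
Proof. by rewrite fin_numE; case: hf => /(_ x) -> _ _ _; rewrite ltey. Qed.

Lemma subdifferential_fin_num x u : subdifferential f x u -> f x \is a fin_num.
Proof.
move=> xu; rewrite fin_numP_Gamma0; case: hf => _ [y fy] _ _.
by have := le_lt_trans (xu y) fy; case: (f x) => [r _| |]; rewrite ?ltry.
Qed.

Lemma subdifferentialP x u : subdifferential f x u ->
  forall y, f y \is a fin_num -> dot (y - x) u + fine (f x) <= fine (f y).
Proof.
move=> xu y fy; have fx := subdifferential_fin_num xu.
by rewrite -lee_fin EFinD !fineK//; exact: xu.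
Qed.

Lemma subdifferential_monotone x y u v :
  subdifferential f x u -> subdifferential f y v -> 0 <= dot (x - y) (u - v).
Proof.
move=> xu yv.
have := subdifferentialP xu (subdifferential_fin_num yv).
have := subdifferentialP yv (subdifferential_fin_num xu).
by rewrite !dotE; move: (fine _) (fine _) => a b; lra.
Qed.

Lemma Gamma0_segment x y (t : R) : 0 < t < 1 ->
  f x \is a fin_num -> f y \is a fin_num ->
  f (t *: x + (1 - t) *: y) \is a fin_num /\
  fine (f (t *: x + (1 - t) *: y)) <= t * fine (f x) + (1 - t) * fine (f y).
Proof.
move=> t01 fx fy; have [_ _ _ /(_ x y t t01) hc] := hf.
have ff : f (t *: x + (1 - t) *: y) \is a fin_num.
  rewrite fin_numP_Gamma0; apply: le_lt_trans hc _.
  by rewrite -(fineK fx) -(fineK fy) -!EFinM -EFinD ltry.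
split => //; rewrite -lee_fin fineK// (le_trans hc)//.
by rewrite -{1}(fineK fx) -{1}(fineK fy) -!EFinM -EFinD.
Qed.

Variables (gamma : R) (x0 u0 : H).
Hypotheses (gamma0 : 0 < gamma) (x0u0 : subdifferential f x0 u0).

Let prox_objective s x := gamma * fine (f x) + dot (x - s) (x - s) / 2.

(** Sublevel sets are [f x <= c x] with [c] continuous, hence closed by lower
    semicontinuity of [f]. *)
Lemma prox_objective_closed s r :
  closed [set x | f x \is a fin_num /\ prox_objective s x <= r].
Proof.
pose c x := (r - dot (x - s) (x - s) / 2) / gamma.
have cc : continuous c.
  move=> x; apply: cvgMl; apply: cvgB; first exact: cvg_cst.
  exact: sqr_norm_continuous.
have Ac x : f x \is a fin_num /\ prox_objective s x <= r <-> (f x <= (c x)%:E)%E.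
  split=> [[fx]|fc].
    rewrite -(fineK fx) lee_fin /c ler_pdivlMr// /prox_objective; lra.
  have fx : f x \is a fin_num by rewrite fin_numP_Gamma0 (le_lt_trans fc)// ltry.
  split => //; move: fc.
  rewrite -(fineK fx) lee_fin /c ler_pdivlMr// /prox_objective; lra.
rewrite closedE /= => x; apply: contra_notP => /Ac/negP; rewrite -ltNge => cf.
have [a ca af] : exists2 a : R, c x < a & (a%:E < f x)%E.
  move: cf; case: (f x) => [w||] //; rewrite ?lte_fin => cf.
    by exists ((c x + w) / 2); rewrite ?lte_fin midf_lt.
  by exists (c x + 1); rewrite ?ltry// ltrDl.
have [_ _ /(_ x a af)[W xW hW] _] := hf.
near=> y => /Ac; apply/negP; rewrite -ltNge.
have : (a%:E < f y)%E by apply: hW; near: y.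
apply: lt_trans; rewrite lte_fin.
by near: y; apply: (cvgr_lt _ (cc x)).
Unshelve. all: by end_near. Qed.

(** The subgradient [u0] at [x0] provides an affine minorant of [f], hence a lower
    bound for the objective after completing a square. *)
Lemma prox_minimizer s : exists2 p, f p \is a fin_num &
  forall y, f y \is a fin_num -> prox_objective s p <= prox_objective s y.
Proof.
pose m := gamma * (fine (f x0) + dot (s - x0) u0) - gamma ^+ 2 * dot u0 u0 / 2.
apply: (@midpoint_convex_minimizer R H [set x | f x \is a fin_num]
  (prox_objective s) m).
- by exists x0; exact: subdifferential_fin_num x0u0.
- move=> x y fx fy; have h12 : 0 < (2^-1 : R) < 1 by lra.
  have [] := @Gamma0_segment x y (2^-1) h12 fx fy.
  have -> : 2^-1 *: x + (1 - 2^-1) *: y = 2^-1 *: (x + y).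
    by rewrite scalerDr; congr (_ + _ *: _); lra.
  move=> ffxy hc; split => //; rewrite /prox_objective sqr_norm_midpoint.
  have := ler_wpM2l (ltW gamma0) hc.
  move: (fine _) (fine _) (fine _) (dot _ _) (dot _ _) (dot _ _).
  by clear => *; lra.
- move=> x fx; have h := ler_wpM2l (ltW gamma0) (subdifferentialP x0u0 fx).
  have := dot_ge0 (x - s + gamma *: u0).
  move: h; rewrite /prox_objective /m !dotE !(dotC _ u0) (dotC x s).
  move: (fine _) (fine _) (dot _ _) (dot _ _) (dot _ _) (dot _ _) (dot _ _).
  move: (dot _ _) (dot _ _).
  by clear => *; lra.
- exact: prox_objective_closed.
Qed.

(** First-order optimality along the segments issued from the minimizer. *)
Lemma prox_subdifferential s : let p := prox (fun t => gamma%:E * f t)%E s in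
  subdifferential f p (gamma^-1 *: (s - p)).
Proof.
have objE x : f x \is a fin_num ->
  (gamma%:E * f x + (`|x - s| ^+ 2 / 2)%:E = (prox_objective s x)%:E)%E.
  by move=> fx; rewrite -(fineK fx) -EFinM -EFinD -dot_norm.
have [p0 fp0 hp0] := prox_minimizer s.
set p := prox _ s => /=.
have : argmin_over setT (fun x => gamma%:E * f x + (`|x - s| ^+ 2 / 2)%:E)%E p.
  rewrite /p /prox; apply: xgetPex; exists p0; split => // y _.
  have [fy|] := boolP (f y \is a fin_num); first by rewrite !objE// lee_fin hp0.
  rewrite fin_numP_Gamma0 -leNgt leye_eq => /eqP ->.
  by rewrite mulry gtr0_sg// mul1e leey.
move: p => p [_ hp].
have fp : f p \is a fin_num.
  have := hp p0 I; rewrite (objE p0)//; apply: contraTT.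
  rewrite fin_numP_Gamma0 -leNgt leye_eq => /eqP ->.
  by rewrite mulry gtr0_sg// mul1e.
move=> y; rewrite -/(dot _ _).
have [fy|] := boolP (f y \is a fin_num); last first.
  by rewrite fin_numP_Gamma0 -leNgt leye_eq => /eqP ->; exact: leey.
rewrite -(fineK fp) -(fineK fy) -EFinD lee_fin -(ler_pM2l gamma0) -subr_ge0.
rewrite dotZr mulrDr mulVKf ?gt_eqF//.
apply: (@first_order_ge0 _ _ (dot (y - p) (y - p) / 2)) => t t01.
have [fpy hc] := @Gamma0_segment y p t t01 fy fp.
have := hp (t *: y + (1 - t) *: p) I; rewrite !objE// lee_fin /prox_objective.
have := ler_wpM2l (ltW gamma0) hc.
have -> : t *: y + (1 - t) *: p - s = (p - s) + t *: (y - p).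
  by rewrite scalerBl scale1r scalerBr addrCA addrA -addrA [RHS]addrAC.
move: (fine _) (fine _) (fine _) => a b c.
rewrite !dotE !(dotC _ y) (dotC p s).
by clear => *; lra.
Qed.

(** By monotonicity two points with this property satisfy [- |q - p|^2 >= 0]. *)
Lemma prox_unique s p : subdifferential f p (gamma^-1 *: (s - p)) ->
  prox (fun t => gamma%:E * f t)%E s = p.
Proof.
move=> ps; have := subdifferential_monotone (prox_subdifferential s) ps.
set q := prox _ _; move: q => q; rewrite -scalerBr dotZr pmulr_rge0 ?invr_gt0//.
have -> : s - q - (s - p) = - (q - p) by rewrite !opprD addrACA subrr add0r.
rewrite dotNr oppr_ge0 => /dot_eq0 qp; apply/eqP; rewrite -subr_eq0; exact/eqP.
Qed.

Lemma prox_nonexpansive s s' : `|prox (fun t => gamma%:E * f t)%E s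
  - prox (fun t => gamma%:E * f t)%E s'| <= `|s - s'|.
Proof.
have := subdifferential_monotone (prox_subdifferential s) (prox_subdifferential s').
rewrite -scalerBr dotZr pmulr_rge0 ?invr_gt0//.
move: (prox _ s) (prox _ s') => p p' h.
rewrite -(@ler_pXn2r _ 2)// ?nnegrE// -!dot_norm.
have e : s - p - (s' - p') = (s - s') - (p - p') by vector_identity.
rewrite e in h; move: (s - s') (p - p') h => t q h; have := dot_ge0 (t - q).
by move: h; rewrite !dotE (dotC t q); lra.
Qed.

End Subdifferential.

(** * Nonnegative sequences with bounded partial sums *)

Section BoundedSums.
Context {R : realType}.
Implicit Types (a b e w : nat -> R).

Definition bounded_sums a := exists M, forall n, \sum_(i < n) a i <= M.

Lemma bounded_sums_lty a : (forall n, 0 <= a n) -> bounded_sums a ->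
  (\sum_(0 <= n <oo) (a n)%:E < +oo)%E.
Proof.
move=> a0 [M aM]; apply: le_lt_trans (ltry M); apply: lime_le.
  by apply: is_cvg_nneseries => n _ _; rewrite lee_fin.
by apply: nearW => n; rewrite sumEFin lee_fin big_mkord.
Qed.

Lemma lty_bounded_sums a : (forall n, 0 <= a n) ->
  (\sum_(0 <= n <oo) (a n)%:E < +oo)%E -> bounded_sums a.
Proof.
move=> a0 ha; set S := (\sum_(0 <= n <oo) (a n)%:E)%E in ha.
have S0 : (0 <= S)%E by apply: nneseries_ge0 => n _ _; rewrite lee_fin.
exists (fine S) => n; rewrite -lee_fin fineK ?ge0_fin_numE//.
rewrite -(big_mkord xpredT a) -sumEFin; apply: nneseries_lim_ge => k _ _.
by rewrite lee_fin.
Qed.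

Lemma bounded_sums_le a b : (forall n, a n <= b n) -> bounded_sums b -> bounded_sums a.
Proof. by move=> ab [M bM]; exists M => n; apply: le_trans (bM n); apply: ler_sum. Qed.

Lemma bounded_sumsD a b : bounded_sums a -> bounded_sums b ->
  bounded_sums (fun n => a n + b n).
Proof.
by move=> [M aM] [N bN]; exists (M + N) => n; rewrite big_split lerD.
Qed.

Lemma bounded_sumsZ c a : 0 <= c -> bounded_sums a -> bounded_sums (fun n => c * a n).
Proof. by move=> c0 [M aM]; exists (c * M) => n; rewrite -mulr_sumr ler_wpM2l. Qed.

Lemma bounded_sums_eventually a b N : (forall n, 0 <= a n) -> (forall n, 0 <= b n) ->
  (forall n, (N <= n)%N -> a n <= b n) -> bounded_sums b -> bounded_sums a.
Proof.
move=> a0 b0 ab [M bM]; exists (M + \sum_(i < N) a i) => n.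
apply: le_trans (lerD (bM n) (lexx _)); elim: n => [|n IH].
  by rewrite !big_ord0 add0r sumr_ge0.
have [nN|Nn] := ltnP n N; last first.
  by rewrite !big_ord_recr /= -[leRHS]addrAC lerD// ab.
apply: (@le_trans _ _ (\sum_(i < N) a i)); last by rewrite lerDr sumr_ge0.
rewrite -(subnKC nN) big_split_ord /= lerDl sumr_ge0//.
Qed.

Lemma quasi_decreasing_summable a e S : (forall n, 0 <= a n) ->
  (forall n, a n.+1 + S n <= a n + e n) -> bounded_sums e -> bounded_sums S.
Proof.
move=> a0 aS [M eM]; exists (a 0%N + M) => n.
suff : a n + \sum_(i < n) S i <= a 0%N + \sum_(i < n) e i.
  by have := eM n; have := a0 n; lra.
elim: n => [|n IH]; first by rewrite !big_ord0.
by rewrite !big_ord_recr /=; have := aS n; lra.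
Qed.

Lemma bounded_sums_cvg0 a : (forall n, 0 <= a n) -> bounded_sums a -> a @ \oo --> 0.
Proof.
move=> a0 [M aM]; apply: cvg_series_cvg_0.
apply: nondecreasing_is_cvgn.
  by apply/nondecreasing_seqP => n; rewrite seriesEnat /= big_nat_recr //= lerDl.
by exists M => _ [n _ <-]; rewrite seriesEnat /= big_mkord; exact: aM.
Qed.

(** Subtracting the partial sums of the errors makes the sequence nonincreasing. *)
Lemma quasi_decreasing_cvg a e : (forall n, 0 <= a n) -> (forall n, 0 <= e n) ->
  (forall n, a n.+1 <= a n + e n) -> bounded_sums e -> cvg (a @ \oo).
Proof.
move=> a0 e0 ae [M eM]; pose E n := \sum_(i < n) e i.
have cE : cvg (E @ \oo).
  apply: nondecreasing_is_cvgn; last by exists M => _ [n _ <-]; exact: eM.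
  by apply/nondecreasing_seqP => n; rewrite /E big_ord_recr lerDl.
have cb : cvg ((fun n => a n - E n) @ \oo).
  apply: nonincreasing_is_cvgn.
    apply/nonincreasing_seqP => n; rewrite /E big_ord_recr /=.
    by have := ae n; lra.
  by exists (- M) => _ [n _ <-]; have := eM n; have := a0 n; rewrite /E; lra.
have -> : a = (fun n => (a n - E n) + E n) by apply/funext => n; rewrite subrK.
exact: is_cvgD.
Qed.

Lemma quasi_decreasing_bounded a e : (forall n, 0 <= a n) ->
  (forall n, a n.+1 <= a n + e n) -> bounded_sums e ->
  exists2 B, 0 <= B & forall n, a n <= B.
Proof.
move=> a0 ae [M eM]; exists (a 0%N + M) => [|n].
  by have := eM 0%N; rewrite big_ord0; have := a0 0%N; lra.
suff : a n <= a 0%N + \sum_(i < n) e i by have := eM n; lra.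
elim: n => [|n IH]; first by rewrite big_ord0; lra.
by rewrite big_ord_recr /=; have := ae n; lra.
Qed.

(** The limit exists; were it positive, the weights would be dominated by a
    multiple of the summable products. *)
Lemma quasi_decreasing_cvg0 a e w : (forall n, 0 <= a n) -> (forall n, 0 <= e n) ->
  (forall n, 0 <= w n) -> (forall n, a n.+1 <= a n + e n) -> bounded_sums e ->
  bounded_sums (fun n => w n * a n ^+ 2) -> ~ bounded_sums w -> a @ \oo --> 0.
Proof.
move=> a0 e0 w0 ae be bwa; apply: contra_notP => na0.
have ca := quasi_decreasing_cvg a0 e0 ae be.
set l := lim (a @ \oo) in ca.
have l0 : 0 < l.
  rewrite lt_neqAle limr_ge ?andbT//; last exact: nearW.
  by apply: contra_notN na0 => /eqP ->.
have l2 : 0 < 4 / l ^+ 2 by rewrite divr_gt0// exprn_gt0.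
have [N _ hN] : \forall n \near \oo, l / 2 < a n.
  by apply: (cvgr_gt _ ca); rewrite ltr_pdivrMr// ltr_pMr// ltr1n.
apply: (@bounded_sums_eventually _ (fun n => 4 / l ^+ 2 * (w n * a n ^+ 2)) N) => //.
- move=> n; apply: mulr_ge0; first exact: ltW.
  by apply: mulr_ge0 => //; exact: exprn_ge0.
- move=> n /hN /= /ltW la; rewrite mulrCA ler_peMr//.
  rewrite mulrAC ler_pdivlMr ?exprn_gt0// mul1r.
  have : (l / 2) ^+ 2 <= a n ^+ 2.
    by rewrite ler_pXn2r ?nnegrE// divr_ge0// ltW.
  by rewrite exprMn exprVn; lra.
- by apply: bounded_sumsZ => //; exact: ltW.
Qed.

End BoundedSums.

(** * Weak limits along ultrafilters *)

Section WeakLimits.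
Context {R : realType} {H : hilbertType R}.
Implicit Types (U : set_system nat) (z : nat -> H) (c u : H).

Lemma bounded_ultra_cvg U (r : nat -> R) (M : R) : UltraFilter U ->
  (forall n, `|r n| <= M) -> cvg (r @ U).
Proof.
move=> UF rM; have PU : ProperFilter U := ultra_proper.
have [p [_ hp]] : `[- M, M]%classic `&` cluster (r @ U) !=set0.
  apply: segment_compact; apply: nearW => n /=.
  by rewrite in_itv /= -ler_norml.
apply/cvg_ex; exists p => B pB.
have [//|UnB] := in_ultra_setVsetC (r @^-1` B) UF.
by have [t [nBt Bt]] := hp (~` B) B UnB pB.
Qed.

(** The limits of [<z_n, u>] along [U] define a bounded linear form in [u]. *)
Lemma bounded_ultra_weak_limit U z (M : R) : UltraFilter U ->
  (forall n, `|z n| <= M) ->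
  exists c, forall u, dot (z n) u @[n --> U] --> dot c u.
Proof.
move=> UF zM; have PU : ProperFilter U := ultra_proper.
have cv u : cvg (dot (z n) u @[n --> U]).
  apply: (@bounded_ultra_cvg _ _ (M * `|u|)) => n.
  by apply: le_trans (dot_cauchy_schwarz _ _) _; rewrite ler_wpM2r.
pose L u := lim (dot (z n) u @[n --> U]).
have [|||c hc] := @riesz_representation R H L M.
- move=> u v; apply: cvg_lim => //; under eq_fun do rewrite dotDr.
  by apply: cvgD; exact: cv.
- move=> k u; apply: cvg_lim => //; under eq_fun do rewrite dotZr.
  by apply: cvgMr; exact: cv.
- move=> u; rewrite ler_norml; apply/andP.
  have zu n : `|dot (z n) u| <= M * `|u|.
    by apply: le_trans (dot_cauchy_schwarz _ _) _; rewrite ler_wpM2r.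
  split; [apply: limr_ge|apply: limr_le]; do ?exact: cv.
    by apply: nearW => n; have := zu n; rewrite ler_norml => /andP[].
  by apply: nearW => n; have := zu n; rewrite ler_norml => /andP[].
exists c => u; rewrite -hc; exact: cv.
Qed.

(** For two weak cluster points [c], [c'] in [F], the difference of the squared
    distances shows that [<z_n, c - c'>] converges, so it has the same limit
    [<c, c - c'> = <c', c - c'>] along both ultrafilters, and [c = c']. *)
Lemma opial z (F : set H) : F !=set0 ->
  (forall c, F c -> cvg (dot (z n - c) (z n - c) @[n --> \oo])) ->
  (forall U c, UltraFilter U -> \oo `<=` U ->
     (forall u, dot (z n) u @[n --> U] --> dot c u) -> F c) ->
  exists2 c, F c & forall u, dot (z n) u @[n --> \oo] --> dot c u.
Proof.
move=> [c0 Fc0] cvF demi.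
have [M zM] : exists M, forall n, `|z n| <= M.
  have /cvg_seq_bounded[M [_ hM]] := cvF _ Fc0.
  pose K := `|M| + 1.
  have hK n : dot (z n - c0) (z n - c0) <= K.
    apply: le_trans (ler_norm _) _; apply: (hM K) => //.
    by rewrite /K (le_lt_trans (ler_norm M))// ltrDl.
  exists (`|c0| + (1 + K)) => n.
  rewrite -[z n](subrK c0) addrC (le_trans (ler_normD _ _))// lerD2l.
  have := hK n; rewrite dot_norm; set t := `|_ - _|.
  have : 0 <= t by rewrite /t.
  move: t K {hK} => t K t0 tK.
  by have [t1|t1] := lerP t 1; nra.
have [U [UF UN]] := ultraFilterLemma (F := \oo) _.
have [c hc] := bounded_ultra_weak_limit UF zM.
have Fc := demi U c UF UN hc; exists c => // u.
apply/cvgrPdist_lt => e e0; apply: contrapT => nA.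
pose A := [set n : nat | e <= `|dot c u - dot (z n) u|].
have PA : ProperFilter (within A \oo).
  apply: Build_ProperFilter_ex => P AP; apply: contrapT => nP; apply: nA.
  apply: (@filterS _ \oo _ (fun n => A n -> P n)); last exact: AP.
  move=> n APn; rewrite ltNge; apply/negP => An.
  by apply: nP; exists n; exact: APn.
have [U' [UF' UA]] := ultraFilterLemma (F := within A \oo) PA.
have UN' : \oo `<=` U' by move=> P NP; apply: UA; apply: filterS NP => n ? _.
have [c' hc'] := bounded_ultra_weak_limit UF' zM.
have Fc' := demi U' c' UF' UN' hc'.
have PU : ProperFilter U := ultra_proper.
have PU' : ProperFilter U' := ultra_proper.
have [l hl] : exists l : R, dot (z n) (c - c') @[n --> \oo] --> l.
  suff : cvg (dot (z n) (c - c') @[n --> \oo]) by move=> /cvg_ex.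
  have -> : (fun n => dot (z n) (c - c')) = (fun n => 2^-1 *
      (dot (z n - c') (z n - c') - dot (z n - c) (z n - c)
        + (dot c c - dot c' c'))).
    apply/funext => n; rewrite !dotE (dotC c (z n)) (dotC c' (z n)).
    by move: (dot _ _) (dot _ _) (dot _ _) (dot _ _) (dot _ _) => *; field.
  apply: is_cvgMr; apply: is_cvgD; last exact: is_cvg_cst.
  by apply: is_cvgB; exact: cvF.
have along (W : set_system nat) k : UltraFilter W -> \oo `<=` W ->
    (forall u, dot (z n) u @[n --> W] --> dot k u) -> dot k (c - c') = l.
  move=> UW NW hk; have PW : ProperFilter W := ultra_proper.
  have hlW : dot (z n) (c - c') @[n --> W] --> l by move=> B /hl; exact: NW.
  by rewrite -(cvg_lim _ (hk (c - c')))//; exact: cvg_lim hlW.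
have e1 := along U c UF UN hc; have e2 := along U' c' UF' UN' hc'.
have cc' : c = c'.
  apply/eqP; rewrite -subr_eq0; apply/eqP/dot_eq0.
  by rewrite dotDl dotNl e1 e2 subrr.
have UAA : U' A by apply: UA; exact: withinT.
have : \forall n \near U', `|dot c u - dot (z n) u| < e.
  by apply: cvgr_dist_lt => //; rewrite cc'; exact: hc'.
move=> /filterI /(_ UAA) /filter_ex [n [ne]].
by rewrite /A /= leNgt ne.
Qed.

End WeakLimits.

(** * Perturbed relaxations of a cocoercive operator *)

Section PerturbedIteration.
Context {R : realType} {H : hilbertType R}.
Variables (U : H -> H) (kappa : R).
Hypothesis kappa0 : 0 < kappa.
Hypothesis cocoU : forall z w : H,
  2 * dot (U z - U w) (z - w) + kappa * dot (U z - U w) (U z - U w) <= 0.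
Implicit Types (z w c : H).

Lemma relaxed_step_fejer c z (t : R) : U c = 0 -> 0 <= t ->
  dot (z + t *: U z - c) (z + t *: U z - c) + t * (kappa - t) * dot (U z) (U z)
  <= dot (z - c) (z - c).
Proof.
move=> Uc t0; have := cocoU z c; rewrite Uc subr0 => h.
have -> : z + t *: U z - c = (z - c) + t *: U z by rewrite addrAC.
move: (z - c) (U z) h => y u h; rewrite !dotE (dotC y u).
by have := ler_wpM2l t0 h; rewrite mulr0; lra.
Qed.

(** Cocoercivity between the two ends of the step bounds the scalar product of
    [U z] with the increment of [U] by minus the squared increment. *)
Lemma relaxed_step_residual_le z (t : R) : 0 < t -> t <= kappa ->
  dot (U (z + t *: U z)) (U (z + t *: U z)) <= dot (U z) (U z).
Proof.
move=> t0 tk; have := cocoU (z + t *: U z) z; rewrite addrAC subrr add0r dotZr.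
set u := U z; set v := U _ => h; rewrite -(ler_pM2l t0).
have -> : dot v v = dot u u + 2 * dot (v - u) u + dot (v - u) (v - u).
  by rewrite !dotDl !dotDr !dotNl !dotNr (dotC v u); lra.
move: (dot_ge0 (v - u)) h.
move: (dot (v - u) _) (dot (v - u) _) (dot u u) => a b q b0 h.
have : t * b <= kappa * b by rewrite ler_wpM2r.
by lra.
Qed.

Lemma operator_lipschitz z w : `|U z - U w| <= 2 / kappa * `|z - w|.
Proof.
rewrite mulrAC ler_pdivlMr// mulrC.
have := cocoU z w; have := dot_cauchy_schwarz (U z - U w) (z - w).
rewrite ler_norml => /andP[+ _]; rewrite dot_norm.
set p := `|U z - U w|; set q := `|z - w|.
have p0 : 0 <= p by rewrite /p.
have q0 : 0 <= q by rewrite /q.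
move: (dot _ _) => s; move: p q p0 q0 => p q; rewrite le_eqVlt => /predU1P[<-|p0] q0.
  by rewrite mulr0 => _ _; exact: mulr_ge0.
by move=> h1 h2; rewrite -(ler_pM2r p0); move: h1 h2; rewrite expr2; lra.
Qed.

Variables (z : nat -> H) (lam : nat -> R) (err : nat -> H).
Hypothesis lam01 : forall n, 0 < lam n < kappa.
Hypothesis zS : forall n, z n.+1 = z n + lam n *: U (z n) + lam n *: err n.
Hypothesis err_sum : bounded_sums (fun n => lam n * `|err n|).

Let lam0 n : 0 < lam n. Proof. by case/andP: (lam01 n). Qed.

Let eps n : R := lam n * `|err n|.

Let eps0 n : 0 <= eps n. Proof. by rewrite mulr_ge0// ltW. Qed.

Lemma norm_scaled_error n : `|lam n *: err n| = eps n.
Proof. by rewrite normrZ gtr0_norm. Qed.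

Lemma distance_quasi_decreasing c n : U c = 0 ->
  `|z n.+1 - c| <= `|z n - c| + eps n.
Proof.
move=> Uc; rewrite zS [_ + lam n *: err n - c]addrAC.
rewrite (le_trans (ler_normD _ _))// norm_scaled_error lerD2r.
rewrite -(@ler_pXn2r _ 2)// ?nnegrE// -!dot_norm.
apply: le_trans (relaxed_step_fejer (z n) Uc (ltW (lam0 n))).
rewrite lerDl; case/andP: (lam01 n) => l0 lk.
by apply: mulr_ge0 (dot_ge0 _); apply: mulr_ge0; lra.
Qed.

Lemma residual_quasi_decreasing n :
  `|U (z n.+1)| <= `|U (z n)| + 2 / kappa * eps n.
Proof.
have step : z n.+1 - (z n + lam n *: U (z n)) = lam n *: err n.
  by rewrite zS addrC addKr.
have := operator_lipschitz (z n.+1) (z n + lam n *: U (z n)).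
rewrite step norm_scaled_error.
have : `|U (z n + lam n *: U (z n))| <= `|U (z n)|.
  rewrite -(@ler_pXn2r _ 2)// ?nnegrE// -!dot_norm.
  by case/andP: (lam01 n) => l0 lk; apply: relaxed_step_residual_le => //; exact: ltW.
move: (U (z n + _)) (U (z n.+1)) => v w h1 h2.
by rewrite -[w](subrK v) addrC (le_trans (ler_normD _ _))// lerD.
Qed.

Lemma distance_bounded c : U c = 0 -> exists2 B, 0 <= B & forall n, `|z n - c| <= B.
Proof.
move=> Uc; apply: (@quasi_decreasing_bounded _ _ eps) => // n.
exact: distance_quasi_decreasing.
Qed.

Lemma residual_bounded : exists2 B, 0 <= B & forall n, `|U (z n)| <= B.
Proof.
apply: (@quasi_decreasing_bounded _ _ (fun n => 2 / kappa * eps n)) => //.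
  by move=> n; exact: residual_quasi_decreasing.
by apply: bounded_sumsZ => //; apply: divr_ge0 => //; exact: ltW.
Qed.

Lemma eps_bounded : exists2 M, 0 <= M & forall n, eps n <= M.
Proof.
have [M hM] := err_sum; exists M; first by have := hM 0%N; rewrite big_ord0.
move=> n; have := hM n.+1; rewrite big_ord_recr /= -/(eps n).
by apply: le_trans; rewrite lerDr sumr_ge0// => i _; exact: eps0.
Qed.

(** Whatever an exact step gains on the squared distance to a zero is summable;
    the errors only cost a multiple of [lam n * |err n|] because distances stay
    bounded. *)
Lemma fejer_slack_summable c (S : nat -> R) : U c = 0 -> 
  (forall n, dot (z n + lam n *: U (z n) - c) (z n + lam n *: U (z n) - c) + S n
     <= dot (z n - c) (z n - c)) ->
  (forall n, 0 <= S n) -> bounded_sums S.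
Proof.
move=> Uc hS S0; have [B B0 hB] := distance_bounded Uc.
have [M M0 hM] := eps_bounded.
apply: (@quasi_decreasing_summable _ (fun n => dot (z n - c) (z n - c))
  (fun n => (2 * B + M) * eps n)).
- by move=> n; exact: dot_ge0.
- move=> n; have := hS n; rewrite [z n.+1]zS [_ + lam n *: err n - c]addrAC.
  have zB : dot (z n - c) (z n - c) <= B ^+ 2.
    by rewrite dot_norm ler_pXn2r ?nnegrE.
  have hn : dot (lam n *: err n) (lam n *: err n) = eps n ^+ 2.
    by rewrite dot_norm norm_scaled_error.
  have := dot_cauchy_schwarz (z n + lam n *: U (z n) - c) (lam n *: err n).
  rewrite norm_scaled_error ler_norml => /andP[_].
  have : `|z n + lam n *: U (z n) - c| <= B => [|wB].
    rewrite -(@ler_pXn2r _ 2)// ?nnegrE// -!dot_norm.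
    by have := hS n; have := S0 n; lra.
  move: (z n + _ - c) (lam n *: err n) wB hn => w h wB hn wh hw.
  have -> : dot (w + h) (w + h) = dot w w + 2 * dot w h + eps n ^+ 2.
    by rewrite -hn !dotE (dotC h w); lra.
  have : `|w| * eps n <= B * eps n by rewrite ler_wpM2r.
  have : eps n * eps n <= M * eps n by rewrite ler_wpM2r.
  move: wh hw; rewrite expr2; move: (`|w| * eps n) => q.
  by lra.
- by apply: bounded_sumsZ => //; lra.
Qed.

Hypothesis fixU : exists c, U c = 0.
Hypothesis lam_div : ~ bounded_sums (fun n => lam n * (kappa - lam n)).

Lemma weighted_residual_summable :
  bounded_sums (fun n => lam n * (kappa - lam n) * dot (U (z n)) (U (z n))).
Proof.
have [c Uc] := fixU; apply: (fejer_slack_summable Uc) => n.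
  by apply: relaxed_step_fejer => //; exact: ltW.
case/andP: (lam01 n) => l0 lk.
by apply: mulr_ge0 (dot_ge0 _); apply: mulr_ge0; lra.
Qed.

Lemma residual_cvg0 : `|U (z n)| @[n --> \oo] --> (0 : R).
Proof.
apply: (@quasi_decreasing_cvg0 _ (fun n => `|U (z n)| : R)
  (fun n => 2 / kappa * eps n) (fun n => lam n * (kappa - lam n))) => //.
- by move=> n; apply: mulr_ge0 => //; apply: divr_ge0 => //; exact: ltW.
- by move=> n; case/andP: (lam01 n) => l0 lk; apply: mulr_ge0; lra.
- by move=> n; exact: residual_quasi_decreasing.
- by apply: bounded_sumsZ => //; apply: divr_ge0 => //; exact: ltW.
- by apply: bounded_sums_le weighted_residual_summable => n; rewrite dot_norm.
Qed.

Lemma iteration_step_cvg0 : `|z n.+1 - z n| @[n --> \oo] --> (0 : R).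
Proof.
apply: (@squeeze_cvgr _ _ _ _ (fun=> 0) (fun n => kappa * `|U (z n)| + eps n)).
- apply: nearW => n; rewrite normr_ge0 /= zS -[z n + _ + _]addrA [z n + _]addrC addrK.
  rewrite (le_trans (ler_normD _ _))// norm_scaled_error lerD2r normrZ.
  by case/andP: (lam01 n) => l0 lk; rewrite gtr0_norm// ler_wpM2r// ltW.
- exact: cvg_cst.
- rewrite -[X in _ --> X](addr0 0); apply: cvgD.
    by rewrite -[X in _ --> X](mulr0 kappa); apply: cvgMr; exact: residual_cvg0.
  exact: bounded_sums_cvg0.
Qed.

(** By [opial], only demiclosedness is needed: a weak limit [c] of [z] along an
    ultrafilter satisfies [kappa |U c|^2 <= h n] with [h] tending to 0, by
    cocoercivity between [z n] and [c]. *)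
Lemma iteration_weak_cvg :
  exists2 c, U c = 0 & forall u, dot (z n) u @[n --> \oo] --> dot c u.
Proof.
apply: (@opial _ _ z [set c | U c = 0]) => //.
- move=> c Uc; have cv : cvg ((`|z n - c| : R) @[n --> \oo]).
    by apply: (@quasi_decreasing_cvg _ _ eps) => // n; exact: distance_quasi_decreasing.
  under eq_fun do rewrite dot_norm expr2; exact: is_cvgM.
move=> F c UF NF hc /=; have PF : ProperFilter F := ultra_proper.
have [c0 Uc0] := fixU; have [B0 B00 hB0] := distance_bounded Uc0.
have [B B00' hB] : exists2 B, 0 <= B & forall n, `|z n - c| <= B.
  exists (B0 + `|c0 - c|) => [|n]; first by rewrite addr_ge0.
  rewrite -(subrK c0 (z n)) -addrA (le_trans (ler_normD _ _))// lerD2r.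
  exact: hB0.
have UzF : `|U (z n)| @[n --> F] --> (0 : R).
  by move=> P /residual_cvg0; exact: NF.
pose h n : R := (2 * kappa * `|U c| + 2 * B) * `|U (z n)|
  + 2 * (dot (z n) (U c) - dot c (U c)).
have h0 : h @ F --> (0 : R).
  rewrite -[0](addr0 0); apply: cvgD.
    by rewrite -[X in _ --> X](mulr0 (2 * kappa * `|U c| + 2 * B)); exact: cvgMr.
  rewrite -[X in _ --> X](mulr0 2); apply: cvgMr.
  rewrite -[X in _ --> X](subrr (dot c (U c))).
  by apply: cvgB; [exact: hc|exact: cvg_cst].
apply: dot_eq0; rewrite -(pmulr_rle0 _ kappa0) -(cvg_lim _ h0)//.
apply: limr_ge; first by apply/cvg_ex; exists 0.
apply: nearW => n; rewrite /h.
have := cocoU (z n) c; have k0 := ltW kappa0.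
have e1 : - (`|U (z n)| * `|z n - c|) <= dot (U (z n)) (z n - c).
  by have := dot_cauchy_schwarz (U (z n)) (z n - c); rewrite ler_norml => /andP[].
have e2 : dot (U (z n)) (U c) <= `|U (z n)| * `|U c|.
  exact: le_trans (ler_norm _) (dot_cauchy_schwarz _ _).
have e3 : `|U (z n)| * `|z n - c| <= `|U (z n)| * B by rewrite ler_wpM2l.
have e4 := ler_wpM2l k0 e2.
have e5 : 0 <= kappa * dot (U (z n)) (U (z n)) by apply: mulr_ge0 => //; exact: dot_ge0.
rewrite -[dot (z n) _ - _]/(dot (z n) (U c) + - dot c (U c)) -dotNl -dotDl.
rewrite !(dotDl (U (z n))) !dotNl (dotDr (U (z n)) (- U c)) dotNr.
rewrite (dotDr (U (z n)) (- U c) (U c)) dotNr (dotC (U c) (U (z n))).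
rewrite (dotC (U c) (z n - c)).
move: e1 e2 e3 e4 e5.
move: (dot _ _) (dot _ _) (dot _ _) (dot _ _) (dot _ _).
move: (`|U c|) (`|U (z n)|) (`|z n - c|).
by move=> *; lra.
Qed.

End PerturbedIteration.

(** * The residual operator of the algorithm *)

Local Opaque dot projection gradient prox.

Section VectorEstimates.
Context {R : realType} {H : hilbertType R}.

(** The vectors [k], [A] and [B] are small. Up to them, the second inequality
    makes [<d, d'>] nonpositive, and the first one then bounds [|d'|^2] by
    [(lam - 1) |d|^2]. *)
Lemma drift_contraction_ineq (lam sigma : R) (d d' k A B : H) :
  1 <= lam <= 3 / 2 -> 0 <= sigma ->
  0 <= dot ((2 - 2 * lam) *: d - 2 *: d' + A) (d' - d + B) ->
  dot d' d' + (2 * lam - 1) * dot d d' <= sigma + dot d' k ->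
  dot d' d' <= 3 / 4 * dot d d + 40 * (sigma + dot k k + dot A A + dot B B).
Proof.
case/andP => lam1 lam2 sigma0 mono breg.
(* A small parameter, so that the cross terms consume little of the gap between
   the factor [lam - 1 <= 1/2] and the claimed 3/4. *)
have t0 : 0 < 10^-1 :> R by rewrite invr_gt0.
have young (x y : H) : `|dot x y| <= dot x x / 20 + 5 * dot y y.
  by have := dot_young x y t0; rewrite invrK; lra.
have := young d B; have := young d' B; have := young d' A; have := young d A.
have := young d' k; have := young A B.
rewrite !ler_norml => /andP[_ y1] /andP[_ y2] /andP[y3 y3'].
move=> /andP[_ y4] /andP[y5 _] /andP[y6 _].
have D0 := dot_ge0 d; have D'0 := dot_ge0 d'; have k0 := dot_ge0 k.
have A0 := dot_ge0 A; have B0 := dot_ge0 B.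
rewrite !dotE (dotC A d) (dotC A d') (dotC d' d) in mono.
move: (dot d d) (dot d' d') (dot d d') (dot k k) (dot A A) (dot B B) (dot A B)
  (dot d' k) (dot d A) (dot d' A) (dot d B) (dot d' B)
  mono breg y1 y2 y3 y3' y4 y5 y6 D0 D'0 k0 A0 B0.
move=> D D' c kk AA BB AB dk dA d'A dB d'B mono breg *.
have cs : (2 - lam) * c <= sigma + D' / 20 + 5 * kk.
  have [c0|c0] := lerP c 0; first by apply: (@le_trans _ _ 0); nra.
  by apply: (@le_trans _ _ ((2 * lam - 1) * c)); nra.
have lD : (lam - 1) * D <= D / 2 by nra.
have ldB : (1 - lam) * dB <= D / 40 + 5 / 2 * BB by nra.
lra.
Qed.

Lemma drift_contraction_remainder (lam : R) (k kappa rho rho' v : H) :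
  1 <= lam <= 3 / 2 -> kappa = lam *: rho + v ->
  dot k k <= dot kappa kappa -> dot (k - kappa) (k - kappa) <= dot kappa kappa ->
  dot k k + dot (k + rho' - rho) (k + rho' - rho)
  + dot (k - kappa - rho' + rho) (k - kappa - rho' + rho)
  <= 45 * (dot rho rho + dot rho' rho' + dot v v).
Proof.
case/andP => l1 l2 kE kk kk'.
have := dot_add_le (lam *: rho) v; rewrite -kE dotZl dotZr.
have := dot_add_le (k + rho') (- rho); rewrite (dotNl rho) (dotNr rho) opprK.
have := dot_add_le k rho'; have := dot_add_le (k - kappa) (- rho').
rewrite (dotNl rho') (dotNr rho') opprK.
have := dot_add_le (k - kappa - rho') rho.
have := dot_ge0 rho; have := dot_ge0 rho'; have := dot_ge0 v.
move: kk kk' => {kE}; move: (dot _ _) (dot _ _) (dot _ _) (dot _ _) (dot _ _) (dot _ _)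
  (dot _ _) (dot _ _) (dot _ _) (dot _ _) => a b c d e p q r s t kk kk' p0 e0 d0.
have l94 : lam * lam <= 9 / 4.
  have : 0 <= (3 / 2 - lam) * (3 / 2 + lam) by apply: mulr_ge0; lra.
  by lra.
have := ler_wpM2r d0 l94.
lra.
Qed.

Lemma three_point_expand (lam p q r : R) (a a' l : H) :
  2^-1 * dot a' a' <= q -> 2^-1 * dot (a - a') (a - a') <= r ->
  p = r + q + dot a' (- (- (2 * lam) *: a + l)) ->
  dot a' a' + (2 * lam - 1) * dot a a' <= p - dot a a / 2 + dot a' l.
Proof. by rewrite !dotE (dotC a' a); lra. Qed.

End VectorEstimates.

Section ForwardBackwardResidual.
Context {R : realType} {H : hilbertType R}.
Variables (V : set H) (f : H -> \bar R) (g : H -> R) (beta gamma : R) (x0 u0 : H).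
Hypotheses (hV : closed_subspace V) (hf : Gamma0 f).
Hypotheses (beta0 : 0 < beta) (gamma0 : 0 < gamma).
Hypothesis x0u0 : subdifferential f x0 u0.
Hypothesis coco : forall x y : H, g y + dot (gradient g y) (x - y) + beta / 2 *
  dot (gradient g x - gradient g y) (gradient g x - gradient g y) <= g x.
Implicit Types (x y z u v : H).

Definition forward_step z : H :=
  projection V z - gamma *: projection V (gradient g (projection V z))
  + (projection V z - z).

(** Relaxing along this vector is one exact step of the algorithm. *)
Definition residual z : H :=
  prox (fun t => gamma%:E * f t)%E (forward_step z) - projection V z.

Definition drift w z : H := gamma *:
  (projection V (gradient g (projection V z))
   - projection V (gradient g (projection V w))).

(** The Bregman distance of [gamma g] between the projections of [z] and [w]. *)
Definition bregman w z : R := let x := projection V z in let y := projection V w in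
  gamma * (g x - g y - dot (gradient g y) (x - y)).

Lemma drift_in w z : V (drift w z).
Proof. by apply: subspaceZ => //; apply: subspaceB => //; exact: projection_in. Qed.

Lemma driftB w z z' : drift w z - drift w z' = drift z' z.
Proof. by rewrite /drift -scalerBr opprB addrA subrK. Qed.

Lemma driftN w z : drift z w = - drift w z.
Proof. by rewrite /drift -scalerN opprB. Qed.

Lemma bregman_sym w z :
  bregman w z + bregman z w = dot (drift w z) (projection V z - projection V w).
Proof.
rewrite /drift -(projectionB hV (gradient _ _)) dotZl (dot_projectionl hV).
  rewrite /bregman /=; move: (projection V z) (projection V w) => x y.
  move: (gradient g x) (gradient g y) => p q.
  by rewrite !dotE; move: (g x) (g y) => a b; ring.
by apply: subspaceB => //; exact: projection_in.
Qed.

Lemma bregman_ge w z :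
  beta / (2 * gamma) * dot (drift w z) (drift w z) <= bregman w z.
Proof.
rewrite /drift -(projectionB hV) dotZl dotZr /bregman /=.
set x := projection V z; set y := projection V w.
have := coco x y.
have := projection_dot_le hV (gradient g x - gradient g y).
move: (dot (projection _ _) _) (dot (_ - _) _) (dot _ (x - y)) => a b c ab hc.
have -> : beta / (2 * gamma) * (gamma * (gamma * a)) = gamma * (beta / 2 * a).
  by field; rewrite gt_eqF.
rewrite ler_pM2l//; apply: (@le_trans _ _ (beta / 2 * b)).
  by rewrite ler_pM2l//; apply: divr_gt0.
by move: hc; move: (beta / 2 * b) => k; lra.
Qed.

(** The sum of the two Bregman distances is the scalar product on the right, and
    each of them is bounded below by the cocoercivity of the gradient. *)
Lemma drift_ge0 w z : bregman w z + beta / (2 * gamma) * dot (drift w z) (drift w z)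
  <= dot (drift w z) (projection V z - projection V w).
Proof.
rewrite -bregman_sym lerD2l; have := bregman_ge z w.
by rewrite driftN dotNl dotNr opprK.
Qed.

Lemma residual_monotone w z :
  0 <= dot (projection V (z - w) + (residual z - residual w))
    (projection V (z - w) - (z - w) - drift w z - (residual z - residual w)).
Proof.
have := subdifferential_monotone hf
  (prox_subdifferential hf gamma0 x0u0 (forward_step z))
  (prox_subdifferential hf gamma0 x0u0 (forward_step w)).
rewrite -scalerBr dotZr pmulr_rge0 ?invr_gt0//.
rewrite /residual (projectionB hV).
have -> : drift w z = (projection V z + (projection V z - z) - forward_step z)
   - (projection V w + (projection V w - w) - forward_step w).
  have E (a c v : H) : c = a + (a - v) - (a - c + (a - v)) by vector_identity.
  by rewrite /drift scalerBr; congr (_ - _); exact: E.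
move: (projection V z) (projection V w) (forward_step z) (forward_step w)
  (prox _ (forward_step z)) (prox _ (forward_step w)) => x y s t p q.
have -> : x - y + (p - x - (q - y)) = p - q by vector_identity.
have -> // : x - y - (z - w) - (x + (x - z) - s - (y + (y - w) - t)) -
   (p - x - (q - y)) = s - p - (t - q) by vector_identity.
Qed.

(** Sum of monotonicity of the subdifferential of [f] and of [drift_ge0], after
    completing a square in [d] and [u]. *)
Lemma residual_cocoercive_slack w z (b := beta / gamma)
  (u := residual z - residual w) (d := drift w z) :
  2 * dot u (z - w) + (2 - (2 * b)^-1) * dot u u
  + (2 * b)^-1 * dot ((2 * b) *: d + u) ((2 * b) *: d + u)
  + 2 * (bregman w z - b / 2 * dot d d) <= 0.
Proof.
have b0 : 0 < b by apply: divr_gt0.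
have := residual_monotone w z; have := drift_ge0 w z.
rewrite -/u -/d -(projectionB hV).
have -> : beta / (2 * gamma) = b / 2 by rewrite /b; field; rewrite gt_eqF.
have orth : dot (projection V (z - w)) (projection V (z - w) - (z - w)) = 0.
  by rewrite dotDr dotNr (dot_projection hV) ?subrr//; exact: projection_in.
have ou : dot u (projection V (z - w)) = dot u (projection V (z - w)) by [].
move: (bregman w z) u d (z - w) (projection V (z - w)) orth {ou} => D u d zeta xi orth.
rewrite !dotE in orth *.
rewrite !(dotC d u) !(dotC xi u) !(dotC xi d).
move: (dot u u) (dot d d) (dot xi xi) (dot u d) (dot u xi) (dot u zeta) (dot d xi)
  (dot d zeta) (dot xi zeta) orth => uu dd xx ud ux uz dx dz xz orth h1 h2.
have -> : (2 * b)^-1 * (2 * b * (2 * b * dd + ud) + (2 * b * ud + uu)) =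
  2 * b * dd + 2 * ud + (2 * b)^-1 * uu by field; rewrite gt_eqF.
lra.
Qed.

Lemma bregman_three_point w z z' : bregman w z = bregman z' z + bregman w z'
  + dot (drift w z') (projection V z - projection V z').
Proof.
rewrite /drift -(projectionB hV (gradient _ _)) dotZl (dot_projectionl hV).
  rewrite /bregman /=; 
  move: (projection V z) (projection V z') (projection V w) => x x' y.
  move: (gradient g x') (gradient g y) => p q.
  by rewrite !dotE; move: (g x) (g x') (g y) => a b c; ring.
by apply: subspaceB => //; exact: projection_in.
Qed.

(** When [rho] and [rho'] are small, [u] is nearly [- 2 d] and the relaxed step
    moves the projection by about [- 2 lam d], up to the additional displacement
    [v]. Monotonicity for [f] and interpolation for [g] between the two points
    then become the assumptions of [drift_contraction_ineq]. *)
Lemma drift_contraction w z z' lam (u := residual z - residual w)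
    (u' := residual z' - residual w) (d := drift w z) (d' := drift w z')
    (v := z' - z - lam *: u) (rho := 2 *: d + u) (rho' := 2 *: d' + u') :
  gamma = beta -> 1 <= lam <= 3 / 2 ->
  dot d' d' <= 3 / 4 * dot d d + 2000 * ((bregman w z - dot d d / 2) +
    dot rho rho + dot rho' rho' + dot v v).
Proof.
move=> gb lam12.
pose kappa := lam *: rho + v; pose k := projection V kappa.
pose A := k + rho' - rho; pose B := k - kappa - rho' + rho.
have b12 : beta / (2 * gamma) = 2^-1 by rewrite gb; field; rewrite gt_eqF.
have sigma0 : 0 <= bregman w z - dot d d / 2.
  by have := bregman_ge w z; rewrite b12 -/d subr_ge0 mulrC.
have Pzz : projection V (z' - z) = - (2 * lam) *: d + k.
  transitivity (projection V (- (2 * lam) *: d + kappa)); last first.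
    by rewrite (projection_linear hV) (projection_id hV (drift_in w z)).
  have E (a e y : H) : y = - (2 * lam) *: a + (lam *: (2 *: a + e) + (y - lam *: e)).
    by vector_identity.
  by congr projection; exact: E.
have mono : 0 <= dot ((2 - 2 * lam) *: d - 2 *: d' + A) (d' - d + B).
  have := residual_monotone z z'; rewrite Pzz.
  have -> : drift z z' = d' - d by rewrite /d /d' driftB.
  have E0 (p q r a e : H) :
      p - q = (2 *: a + (p - r) - 2 *: a) - (2 *: e + (q - r) - 2 *: e).
    by vector_identity.
  have E1 (a a' r r' l : H) : - (2 * lam) *: a + l + (r' - 2 *: a' - (r - 2 *: a)) =
      (2 - 2 * lam) *: a - 2 *: a' + (l + r' - r) by vector_identity.
  have E2 (a a' e r' y l : H) : - (2 * lam) *: a + l - y - (a' - a) -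
      (r' - 2 *: a' - (2 *: a + e - 2 *: a)) =
      a' - a + (l - (lam *: (2 *: a + e) + (y - lam *: e)) - r' + (2 *: a + e)).
    by vector_identity.
  by rewrite (E0 _ _ (residual w) d' d) E1 E2.
have breg : dot d' d' + (2 * lam - 1) * dot d d' <=
    (bregman w z - dot d d / 2) + dot d' k.
  have := bregman_three_point w z z'.
  have := bregman_ge z' z; have := bregman_ge w z'; rewrite b12 -/d'.
  have -> : drift z' z = d - d' by rewrite /d /d' driftB.
  have -> : projection V z - projection V z' = - (- (2 * lam) *: d + k).
    by rewrite -Pzz (projectionB hV) opprB.
  move: (bregman w z) (bregman w z') (bregman z' z) => p q r.
  exact: three_point_expand.
apply: le_trans (drift_contraction_ineq lam12 sigma0 mono breg) _.
have kk : dot k k <= dot kappa kappa by exact: projection_dot_le.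
have kk' : dot (k - kappa) (k - kappa) <= dot kappa kappa.
  by rewrite -opprB dotNl dotNr opprK; exact: projection_compl_dot_le.
(* The constant 2000 exceeds 40 * 45, the product of the constants of
   [drift_contraction_ineq] and [drift_contraction_remainder]. *)
have := drift_contraction_remainder rho' lam12 erefl kk kk'; rewrite -/A -/B.
have := dot_ge0 rho; have := dot_ge0 rho'; have := dot_ge0 v.
have := sigma0; move: (bregman w z - dot d d / 2) => s s0.
move: (dot d d) (dot k k) (dot A A) (dot B B) (dot rho rho) (dot rho' rho') (dot v v).
by clear -s0 => *; lra.
Qed.

Lemma residual0_subdifferential z : residual z = 0 ->
  subdifferential f (projection V z)
    (gamma^-1 *: (projection V z - z) - projection V (gradient g (projection V z))).
Proof.
move=> /eqP; rewrite subr_eq0 => /eqP ps.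
have := prox_subdifferential hf gamma0 x0u0 (forward_step z); rewrite /= ps.
congr (subdifferential f _ _); rewrite /forward_step.
have gg : gamma^-1 * gamma = 1 by rewrite mulVf ?gt_eqF.
have E (x q v : H) : gamma^-1 *: (x - gamma *: q + v - x) =
    gamma^-1 *: v - (gamma^-1 * gamma) *: q.
  by vector_identity.
by rewrite E gg scale1r.
Qed.

(** Here [s = x + gamma u] when [z] is the displayed point, and its proximal
    point is [x] by uniqueness. *)
Lemma residual_eq0 x u : V x -> subdifferential f x u ->
  (forall v, V v -> dot v (u + gradient g x) = 0) ->
  residual (x - gamma *: (u + projection V (gradient g x))) = 0.
Proof.
move=> Vx xu orth; set z := _ - _.
have Pz : projection V z = x.
  apply: projection_unique => // v Vv; rewrite /z dotDr dotNr dotZr.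
  have := orth v Vv; rewrite !dotDr (dot_projection hV)// => ->.
  by rewrite mulr0 subr0.
rewrite /residual /forward_step Pz; apply/eqP; rewrite subr_eq0; apply/eqP.
apply: (prox_unique hf gamma0 x0u0); congr (subdifferential f _ _): xu.
have gg : gamma^-1 * gamma = 1 by rewrite mulVf ?gt_eqF.
have E (q e : H) :
    gamma^-1 *: (x - gamma *: q + (x - (x - gamma *: (e + q))) - x) =
    (gamma^-1 * gamma) *: e.
  by vector_identity.
by rewrite /z E gg scale1r.
Qed.

End ForwardBackwardResidual.

(** * Summability over long relaxation steps *)

Section LongSteps.
Context {R : realType} {H : hilbertType R}.
(* [D] stands for the squared drift, [eta] for the slack terms of
   [drift_contraction] and [eps] for the norms of the errors. *)
Variables (z u : nat -> H) (lam D eta eps : nat -> R) (K C M : R).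
Hypothesis lam_bounds : forall n, 0 < lam n < 3 / 2.
Hypotheses (D0 : forall n, 0 <= D n) (eta0 : forall n, 0 <= eta n).
Hypotheses (eps0 : forall n, 0 <= eps n) (K0 : 0 <= K) (C0 : 0 <= C).
Hypothesis D_le : forall n, D n <= eta n + dot (u n) (u n).
Hypothesis u_step : forall n,
  dot (u n.+1) (u n.+1) <= dot (u n) (u n) + C * eps n.
Hypothesis z_step : forall n, `|z n.+1 - z n - lam n *: u n| <= eps n.
Hypothesis D_contraction : forall n k, 1 <= lam n ->
  D k <= 3 / 4 * D n + K * (eta n + eta k +
    dot (z k - z n - lam n *: u n) (z k - z n - lam n *: u n)).
Hypothesis eta_sum : bounded_sums (fun n => lam n * eta n).
Hypothesis u_sum : bounded_sums (fun n => lam n * (3 / 2 - lam n) * dot (u n) (u n)).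
Hypothesis eps_sum : forall n, \sum_(i < n) eps i <= M.

Let r n : R := lam n * eta n + lam n * (3 / 2 - lam n) * dot (u n) (u n) + eps n.

Let u0 n : 0 <= dot (u n) (u n). Proof. exact: dot_ge0. Qed.

Let weighted_u0 n : 0 <= lam n * (3 / 2 - lam n) * dot (u n) (u n).
Proof.
case/andP: (lam_bounds n) => l0 l1.
by apply: mulr_ge0 => //; apply: mulr_ge0; lra.
Qed.

Let weighted_eta0 n : 0 <= lam n * eta n.
Proof. by case/andP: (lam_bounds n) => l0 l1; apply: mulr_ge0 => //; exact: ltW. Qed.

Let short_u n : lam n < 1 -> lam n * dot (u n) (u n) <= 2 * r n - eps n.
Proof.
move=> l1; case/andP: (lam_bounds n) => l0 _.
have := weighted_eta0 n; have := eps0 n; rewrite /r.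
have : 0 <= lam n * (1 - lam n) * dot (u n) (u n).
  by apply: mulr_ge0 => //; apply: mulr_ge0; lra.
by rewrite !mulrBr !mulrBl; lra.
Qed.

Let long_eta n : 1 <= lam n -> eta n + eps n <= r n.
Proof.
move=> l1; have := weighted_u0 n; rewrite /r.
have : eta n <= lam n * eta n by rewrite ler_peMl.
by lra.
Qed.

(** Cauchy-Schwarz for the accumulated displacement: adding a step of length [l]
    and direction of norm [t] preserves [Y^2 <= Lam W]. *)
Lemma sqr_add_le_mul (Lam W t Y l : R) :
  0 <= Lam -> 0 <= W -> 0 <= t -> 0 <= Y -> 0 <= l ->
  Y ^+ 2 <= Lam * W -> (Y + l * t) ^+ 2 <= (Lam + l) * (W + l * t ^+ 2).
Proof.
move=> L0 W0 t0 Y0 l0 YW.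
have key : 2 * (Y * t) <= Lam * t ^+ 2 + W.
  rewrite -(@ler_pXn2r _ 2)// ?nnegrE; last 2 first.
    by apply: mulr_ge0 => //; exact: mulr_ge0.
    by apply: addr_ge0 => //; apply: mulr_ge0 => //; exact: exprn_ge0.
  have := ler_wpM2r (exprn_ge0 2 t0) YW; have := sqr_ge0 (Lam * t ^+ 2 - W).
  by rewrite !exprMn sqrrB sqrrD exprMn; lra.
have := ler_wpM2l l0 key; rewrite sqrrD exprMn; move: YW; rewrite !expr2; lra.
Qed.

(* Large enough to absorb, with weight at least 1, the constants of the step
   bound on [u], of the contraction, and of the square of the accumulated error,
   which is at most [M * E]. *)
Let K2 := 1 + 2 * C + 2 * K + 2 * K * M.

Let M0 : 0 <= M. Proof. by have := eps_sum 0; rewrite big_ord0. Qed.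

Let KM0 : 0 <= K * M. Proof. exact: mulr_ge0. Qed.

(** The credit [q] available before step [N] pays for [D N] if step [N] is long.
    Either the squared residual is already below [q], or there is a long step
    [k] such that the later, short steps have total length [Lam <= 1]; [W] then
    stands for their total weighted squared residual, [E] for the total error
    and [Y + E] for a bound on the displacement. *)
Definition covered (N : nat) (q : R) : Prop :=
  dot (u N) (u N) <= q \/
  exists k Lam W E Y, [/\ 1 <= lam k, 0 <= Lam <= 1, 0 <= W,
    0 <= E <= \sum_(i < N) eps i & 0 <= Y] /\
   [/\ Y ^+ 2 <= Lam * W, `|z N - z k - lam k *: u k| <= Y + E,
    dot (u N) (u N) * Lam <= W + 2 * C * E &
    3 / 4 * D k + K2 * (eta k + W + E) <= q].

(** In the second case this is the contraction between the iterates [k] and [N]. *)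
Lemma covered_le N q : covered N q -> D N <= q + K2 * eta N.
Proof.
have e0 := eta0 N; have Ke := mulr_ge0 K0 e0; have Ce := mulr_ge0 C0 e0.
have KMe := mulr_ge0 KM0 e0.
case=> [uq|[k [Lam [W [E [Y [[lk /andP[L0 L1] W0 /andP[E0 EM] Y0] [YW zY _ hq]]]]]]]].
  by have := D_le N; rewrite /K2; lra.
apply: le_trans (D_contraction N lk) _; have ek := eta0 k.
have Kek := mulr_ge0 K0 ek; have Cek := mulr_ge0 C0 ek; have KMek := mulr_ge0 KM0 ek.
have KW := mulr_ge0 K0 W0; have CW := mulr_ge0 C0 W0; have KMW := mulr_ge0 KM0 W0.
have KE := mulr_ge0 K0 E0; have CE := mulr_ge0 C0 E0; have KME := mulr_ge0 KM0 E0.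
have vv : dot (z N - z k - lam k *: u k) (z N - z k - lam k *: u k)
    <= 2 * W + 2 * (M * E).
  rewrite dot_norm; apply: (@le_trans _ _ ((Y + E) ^+ 2)).
    by rewrite ler_pXn2r ?nnegrE//; exact: addr_ge0.
  have EE : E * E <= M * E by rewrite ler_wpM2r// (le_trans EM).
  have LW : Lam * W <= W by rewrite ler_piMl.
  by have := sqr_ge0 (Y - E); rewrite sqrrB sqrrD; move: YW; rewrite !expr2; lra.
have := ler_wpM2l K0 vv; move: hq; rewrite /K2.
move: (dot _ _) => v; lra.
Qed.

Lemma covered_long N : 1 <= lam N ->
  covered N.+1 (3 / 4 * D N + K2 * (eta N + eps N)).
Proof.
move=> lN; right; exists N, 0, 0, (eps N), 0; split; split => //.
- by rewrite lexx ler01.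
- by rewrite eps0 big_ord_recr /= lerDr sumr_ge0.
- by rewrite add0r.
- by rewrite mulr0 add0r; apply: mulr_ge0 => //; apply: mulr_ge0.
- by rewrite addr0.
Qed.

(** Once the total length exceeds 1, the bound on [Lam * |u N|^2] controls the
    squared residual itself, and the position of the last long step can be
    forgotten. *)
Lemma covered_short N q : lam N < 1 -> covered N q ->
  covered N.+1 (q + K2 * (lam N * dot (u N) (u N) + eps N)).
Proof.
move=> lN; case/andP: (lam_bounds N) => l0 _; have e0 := eps0 N.
have Ke := mulr_ge0 K0 e0; have Ce := mulr_ge0 C0 e0; have KMe := mulr_ge0 KM0 e0.
have lu : 0 <= lam N * dot (u N) (u N) by apply: mulr_ge0 => //; exact: ltW.
have Klu := mulr_ge0 K0 lu; have Clu := mulr_ge0 C0 lu; have KMlu := mulr_ge0 KM0 lu.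
have us := u_step N.
case=> [uq|[k [Lam [W [E [Y [[lk /andP[L0 L1] W0 /andP[E0 EM] Y0] [YW zY uW hq]]]]]]]].
  by left; rewrite /K2; lra.
have KE := mulr_ge0 K0 E0; have CE := mulr_ge0 C0 E0; have KME := mulr_ge0 KM0 E0.
have KW := mulr_ge0 K0 W0; have CW := mulr_ge0 C0 W0; have KMW := mulr_ge0 KM0 W0.
set t2 := dot (u N) (u N) in us uW lu Klu Clu KMlu *.
have uW' : dot (u N.+1) (u N.+1) * (Lam + lam N) <=
    (W + lam N * t2) + 2 * C * (E + eps N).
  apply: (@le_trans _ _ ((t2 + C * eps N) * (Lam + lam N))).
    by rewrite ler_wpM2r// addr_ge0// ltW.
  have : C * eps N * (Lam + lam N) <= C * eps N * 2 by rewrite ler_wpM2l//; lra.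
  by move: uW; rewrite mulrDl !mulrDr; lra.
have [L'1|L'1] := lerP (Lam + lam N) 1; last first.
  left; apply: (@le_trans _ _ (dot (u N.+1) (u N.+1) * (Lam + lam N))).
    by rewrite ler_peMr// ltW.
  have := D0 k; have ek := eta0 k; have Kek := mulr_ge0 K0 ek.
  have Cek := mulr_ge0 C0 ek; have KMek := mulr_ge0 KM0 ek.
  by move: hq uW'; rewrite /K2; lra.
right; exists k, (Lam + lam N), (W + lam N * t2), (E + eps N), (Y + lam N * `|u N|).
split; split => //.
- by rewrite L'1 andbT addr_ge0// ltW.
- exact: addr_ge0.
- by rewrite addr_ge0//= big_ord_recr /= lerD2r.
- by apply: addr_ge0 => //; apply: mulr_ge0 => //; exact: ltW.
- by rewrite /t2 dot_norm; apply: sqr_add_le_mul => //; exact: ltW.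
- have -> : z N.+1 - z k - lam k *: u k = (z N - z k - lam k *: u k)
      + (lam N *: u N + (z N.+1 - z N - lam N *: u N)).
    have E4 (a b c d e : H) : a - b - c = (d - b - c) + (e + (a - d - e)).
      by vector_identity.
    exact: E4.
  apply: le_trans (ler_normD _ _) _.
  rewrite [leRHS]addrACA lerD//.
  apply: le_trans (ler_normD _ _) _; rewrite lerD//.
  by rewrite normrZ gtr0_norm.
- by move: hq; rewrite /K2; lra.
Qed.

Lemma covered_ge0 N q : covered N q -> 0 <= q.
Proof.
case=> [|[k [Lam [W [E [Y [[_ _ W0 /andP[E0 _] _] [_ _ _]]]]]]]]; first exact: le_trans.
apply: le_trans; rewrite addr_ge0//.
  by apply: mulr_ge0 => //; apply: divr_ge0.
by rewrite /K2; apply: mulr_ge0; rewrite !addr_ge0// -?mulrA !mulr_ge0.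
Qed.

(** Each long step replaces the credit, at least [D N] up to small terms, by about
    [3/4 D N], so the sum of [D] over long steps is at most four times the credit
    ever received. The latter is bounded because short steps only receive credit
    in proportion to summable terms, which also control [lam n * D n] for them. *)
Lemma long_steps_summable : bounded_sums (fun n => lam n * D n).
Proof.
pose L n := if 1 <= lam n then D n else 0.
have K20 : 1 <= K2.
  by rewrite /K2; have := mulr_ge0 K0 M0; have := C0; have := K0; lra.
have main N : exists2 q, covered N q &
    q + 4^-1 * \sum_(i < N) L i <= dot (u 0%N) (u 0%N) + 2 * K2 * \sum_(i < N) r i.
  elim: N => [|N [q cq hq]].
    by exists (dot (u 0%N) (u 0%N)); [left|rewrite !big_ord0 !mulr0].
  have [lN|lN] := lerP 1 (lam N).
    exists (3 / 4 * D N + K2 * (eta N + eps N)); first exact: covered_long.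
    have := ler_wpM2l (le_trans ler01 K20) (long_eta lN).
    have := mulr_ge0 (le_trans ler01 K20) (eps0 N).
    rewrite !big_ord_recr /= {2}/L lN; move: hq (covered_le cq).
    move: (\sum_(i < N) L i) (\sum_(i < N) r i) (r N) K2 (dot _ _) => a b c k d.
    by move: (D N) (eta N) (eps N) => *; lra.
  exists (q + K2 * (lam N * dot (u N) (u N) + eps N)); first exact: covered_short.
  have := ler_wpM2l (le_trans ler01 K20) (short_u lN).
  have LN : L N = 0 by rewrite /L leNgt lN.
  rewrite !big_ord_recr /= LN addr0; move: hq.
  move: (\sum_(i < N) L i) (\sum_(i < N) r i) (r N) K2 => a b c k.
  by move: (dot _ _) (dot _ _) (lam N) (eps N) => *; lra.
have sum_r : bounded_sums r.
  apply: bounded_sumsD; first exact: bounded_sumsD.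
  by exists M.
have sum_L : bounded_sums L.
  have [B hB] := sum_r.
  exists (4 * (dot (u 0%N) (u 0%N) + 2 * K2 * B)) => N.
  have [q /covered_ge0 q0 hq] := main N.
  have := ler_wpM2l (mulr_ge0 (ler0n R 2) (le_trans ler01 K20)) (hB N).
  by move: hq; lra.
have r0 n : 0 <= r n.
  have := weighted_u0 n; have := weighted_eta0 n; have := eps0 n.
  by rewrite /r; lra.
apply: (@bounded_sums_le _ _ (fun n => 3 / 2 * L n + 3 * r n)); last first.
  by apply: bounded_sumsD; apply: bounded_sumsZ => //; apply: divr_ge0.
move=> n; have rn := r0 n; rewrite /L; case: (lerP 1 (lam n)) => ln.
  case/andP: (lam_bounds n) => _ /ltW l2.
  by have := ler_wpM2r (D0 n) l2; lra.
case/andP: (lam_bounds n) => /ltW l0 _.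
have : lam n * eta n <= r n by rewrite /r; have := eps0 n; have := weighted_u0 n; lra.
have := ler_wpM2l l0 (D_le n); have := short_u ln; have := eps0 n.
by move: (r n) (D n) (dot _ _) (eta n) => *; lra.
Qed.

End LongSteps.

(** * Summability of the drift *)

Section ForwardPartialInverse.
Context {R : realType} {H : hilbertType R}.
Variables (V : set H) (f : H -> \bar R) (g : H -> R) (beta gamma : R) (x0 u0 : H).
Hypotheses (hV : closed_subspace V) (hf : Gamma0 f).
Hypotheses (beta0 : 0 < beta) (gamma0 : 0 < gamma).
Hypothesis x0u0 : subdifferential f x0 u0.
Hypothesis coco : forall x y : H, g y + dot (gradient g y) (x - y) + beta / 2 *
  dot (gradient g x - gradient g y) (gradient g x - gradient g y) <= g x.

Let U := residual V f g gamma.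

Variable kappa : R.
Hypotheses (kappa0 : 0 < kappa) (kappa_le : kappa <= 2 - gamma / (2 * beta)).

Lemma residual_slack w z (b := beta / gamma) (u := U z - U w)
    (d := drift V g gamma w z) :
  2 * dot u (z - w) + (2 - gamma / (2 * beta)) * dot u u
  + gamma / (2 * beta) * dot ((2 * b) *: d + u) ((2 * b) *: d + u)
  + 2 * (bregman V g gamma w z - b / 2 * dot d d) <= 0.
Proof.
have /= := residual_cocoercive_slack hV hf beta0 gamma0 x0u0 coco w z.
have -> // : (2 * (beta / gamma))^-1 = gamma / (2 * beta).
by field; rewrite !gt_eqF.
Qed.

Lemma bregman_slack_ge0 w z (b := beta / gamma) (d := drift V g gamma w z) :
  0 <= bregman V g gamma w z - b / 2 * dot d d.
Proof.
have := bregman_ge hV beta0 gamma0 coco w z.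
have -> : beta / (2 * gamma) = b / 2 by rewrite /b; field; rewrite gt_eqF.
by rewrite subr_ge0.
Qed.

Lemma residual_cocoercive z w :
  2 * dot (U z - U w) (z - w) + kappa * dot (U z - U w) (U z - U w) <= 0.
Proof.
have /= := residual_slack w z; have /= := bregman_slack_ge0 w z.
have q0 : 0 <= gamma / (2 * beta).
  by apply: divr_ge0; [exact: ltW|rewrite mulr_ge0// ltW].
have := mulr_ge0 q0
  (dot_ge0 ((2 * (beta / gamma)) *: drift V g gamma w z + (U z - U w))).
have := ler_wpM2r (dot_ge0 (U z - U w)) kappa_le.
move: (gamma / (2 * beta)) (dot (U z - U w) (z - w))
  (dot (U z - U w) (U z - U w)) => q p r.
by move: (bregman _ _ _ _ _ - _) (dot (_ + _) _) => *; lra.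
Qed.

Variables (z : nat -> H) (lam : nat -> R) (err : nat -> H).
Hypothesis lam01 : forall n, 0 < lam n < kappa.
Hypothesis zS : forall n, z n.+1 = z n + lam n *: U (z n) + lam n *: err n.
Hypothesis err_sum : bounded_sums (fun n => lam n * `|err n|).
Variable c : H.
Hypothesis Uc : U c = 0.

Let D n : R := dot (drift V g gamma c (z n)) (drift V g gamma c (z n)).

Let sigma n : R := bregman V g gamma c (z n) - beta / gamma / 2 * D n.

Let rho n : H := (2 * (beta / gamma)) *: drift V g gamma c (z n) + U (z n).

Let slack_terms n : [/\ 0 <= lam n, 0 <= sigma n,
  0 <= gamma / (2 * beta) * dot (rho n) (rho n) &
  0 <= (2 - gamma / (2 * beta) - lam n) * dot (U (z n)) (U (z n))].
Proof.
case/andP: (lam01 n) => /ltW l0 lk; split => //; first exact: bregman_slack_ge0.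
- apply: mulr_ge0 (dot_ge0 _); apply: divr_ge0; first exact: ltW.
  by rewrite mulr_ge0// ltW.
- by apply: mulr_ge0 (dot_ge0 _); rewrite subr_ge0 ltW// (lt_le_trans lk).
Qed.

(** Unlike [weighted_residual_summable], this keeps all the terms of
    [residual_slack]. *)
Lemma sharp_slack_summable : bounded_sums (fun n => lam n *
  (2 * sigma n + gamma / (2 * beta) * dot (rho n) (rho n)
    + (2 - gamma / (2 * beta) - lam n) * dot (U (z n)) (U (z n)))).
Proof.
apply: (fejer_slack_summable residual_cocoercive lam01 zS err_sum Uc) => n.
  have /= := residual_slack c (z n); rewrite Uc !subr0 -/(rho n) -/(D n) -/(sigma n).
  case/andP: (lam01 n) => /ltW l0 _; move/(ler_wpM2l l0); rewrite mulr0.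
  have E : z n + lam n *: U (z n) - c = (z n - c) + lam n *: U (z n) by rewrite addrAC.
  rewrite E (_ : dot (_ + _) (_ + _) = dot (z n - c) (z n - c)
     + 2 * lam n * dot (U (z n)) (z n - c)
     + lam n ^+ 2 * dot (U (z n)) (U (z n))); last first.
    move: (z n - c) (U (z n)) (lam n) => x y t.
    by rewrite !dotE (dotC x y) expr2; ring.
  move: (gamma / (2 * beta)) (sigma n) => q s.
  by move: (dot _ _) (dot _ _) (dot _ _) (dot _ _) (lam n) => *; lra.
have [l0 s0 r0 t0] := slack_terms n; apply: mulr_ge0 => //.
move: ((2 - gamma / (2 * beta) - lam n) * _) (gamma / (2 * beta) * _) t0 r0.
by move=> *; lra.
Qed.

(** The margin makes [lam n * |U (z n)|^2] summable, and [2 b d] is the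
    difference of [rho] and [U (z n)]. *)
Lemma drift_summable_of_margin :
  kappa < 2 - gamma / (2 * beta) -> bounded_sums (fun n => lam n * D n).
Proof.
rewrite -subr_gt0; set delta := _ - kappa => delta0.
set b := 2 * (beta / gamma).
have b0 : 0 < b by rewrite mulr_gt0// divr_gt0.
have bq : b * (gamma / (2 * beta)) = 1 by rewrite /b; field; rewrite !gt_eqF.
pose C := (2 * b + 2 / delta) / b ^+ 2.
have C0 : 0 <= C.
  apply: divr_ge0; last by rewrite exprn_ge0// ltW.
  by apply: addr_ge0; [rewrite mulr_ge0// ltW|apply: divr_ge0 => //; exact: ltW].
apply: bounded_sums_le (bounded_sumsZ C0 sharp_slack_summable) => n.
have [l0 s0 r0 t0] := slack_terms n.
rewrite mulrCA; apply: ler_wpM2l => //.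
rewrite /C mulrAC ler_pdivlMr ?exprn_gt0//.
have D_le : D n * b ^+ 2 <= 2 * dot (rho n) (rho n) + 2 * dot (U (z n)) (U (z n)).
  have E (x y : H) :
      dot y y * b ^+ 2 <= 2 * dot (b *: y + x) (b *: y + x) + 2 * dot x x.
    have := dot_add_le (b *: y + x) (- x); rewrite addrK dotNl dotNr opprK dotZl dotZr.
    by rewrite mulrA -expr2 [_ * b ^+ 2]mulrC mulrDr.
  exact: E.
apply: le_trans D_le _.
have rr : dot (rho n) (rho n) = b * (gamma / (2 * beta) * dot (rho n) (rho n)).
  by rewrite mulrA bq mul1r.
have uu : dot (U (z n)) (U (z n)) <= delta^-1 *
    ((2 - gamma / (2 * beta) - lam n) * dot (U (z n)) (U (z n))).
  rewrite ler_pdivlMl// ler_wpM2r ?dot_ge0//.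
  by rewrite /delta lerD2l lerN2; case/andP: (lam01 n) => _ /ltW.
rewrite {1}rr; move: r0 t0 uu.
move: (dot (U (z n)) _) ((2 - gamma / (2 * beta) - lam n) * _)
  (gamma / (2 * beta) * _) => v t p p0 t0 uu.
have h1 := mulr_ge0 (ltW b0) t0.
have h2 := mulr_ge0 (ltW b0) s0.
have dV : 0 <= delta^-1 by rewrite invr_ge0 ltW.
have h3 := mulr_ge0 dV s0; have h4 := mulr_ge0 dV p0.
by move: (delta^-1) uu h3 h4 => k *; lra.
Qed.

Lemma drift_contraction_at_zero n k : gamma = beta -> 1 <= lam n <= 3 / 2 ->
  D k <= 3 / 4 * D n + 2000 * ((bregman V g gamma c (z n) - D n / 2)
   + dot (2 *: drift V g gamma c (z n) + U (z n))
       (2 *: drift V g gamma c (z n) + U (z n))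
   + dot (2 *: drift V g gamma c (z k) + U (z k))
       (2 *: drift V g gamma c (z k) + U (z k))
   + dot (z k - z n - lam n *: U (z n)) (z k - z n - lam n *: U (z n))).
Proof.
move=> gb l32.
have := drift_contraction hV hf beta0 gamma0 x0u0 coco c (z n) (z k) gb l32.
by rewrite -/U Uc !subr0.
Qed.

Lemma drift_summable_of_equal_steps : gamma = beta -> kappa = 3 / 2 ->
  bounded_sums (fun n => lam n * D n).
Proof.
move=> gb k32.
have bg : beta / gamma = 1 by rewrite gb divff// gt_eqF.
have q12 : gamma / (2 * beta) = 2^-1 by rewrite gb; field; rewrite gt_eqF.
have [B B0 hB] := residual_bounded kappa0 residual_cocoercive lam01 zS err_sum.
have [N N0 hN] := eps_bounded lam01 err_sum.
have [M hM] := err_sum.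
have kV0 : 0 <= 2 / kappa by rewrite divr_ge0// ltW.
have e0 n : 0 <= lam n * `|err n|.
  by case/andP: (lam01 n) => /ltW l0 _; exact: mulr_ge0.
have rho1 n : rho n = 2 *: drift V g gamma c (z n) + U (z n).
  by rewrite /rho bg mulr1.
have sigma1 n : sigma n = bregman V g gamma c (z n) - D n / 2.
  by rewrite /sigma bg mul1r [2^-1 * _]mulrC.
apply: (@long_steps_summable _ _ z (fun n => U (z n)) lam D
  (fun n => sigma n + dot (rho n) (rho n)) (fun n => lam n * `|err n|) 2000
  (2 / kappa * (2 * B + 2 / kappa * N)) M).
- by move=> n; rewrite -k32.
- by move=> n; exact: dot_ge0.
- by move=> n; have [_ s0 _ _] := slack_terms n; rewrite addr_ge0// dot_ge0.
- exact: e0.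
- exact: ler0n.
- by apply: mulr_ge0 => //; rewrite addr_ge0// mulr_ge0.
- move=> n; have [_ s0 _ _] := slack_terms n; rewrite rho1 -addrA ler_wpDl// /D.
  have E (x y : H) : dot y y <= dot (2 *: y + x) (2 *: y + x) + dot x x.
    have := dot_add_le (2 *: y + x) (- x).
    rewrite addrK dotNl dotNr opprK dotZl dotZr.
    by have := dot_ge0 y; move: (dot y y) (dot x x) (dot _ _) => *; lra.
  exact: E.
- move=> n; have h := residual_quasi_decreasing kappa0 residual_cocoercive lam01 zS n.
  rewrite /= in h; rewrite !dot_norm.
  apply: (@le_trans _ _ ((`|U (z n)| + 2 / kappa * (lam n * `|err n|)) ^+ 2)).
    by rewrite ler_pXn2r ?nnegrE// addr_ge0// mulr_ge0.
  have hBn := hB n; have hNn := hN n; have e0n := e0 n; rewrite /= in hNn.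
  have nU : 0 <= `|U (z n)| by [].
  move: (`|U (z n)|) (lam n * `|err n|) (2 / kappa) kV0 nU hBn hNn e0n.
  move=> v e k k0 v0 vB eN ee0.
  have h1 : e * v <= e * B by rewrite ler_wpM2l.
  have h2 : e * (k * e) <= e * (k * N) by rewrite ler_wpM2l// ler_wpM2l.
  have := ler_wpM2l k0 (lerD (lerD h1 h1) h2); rewrite sqrrD; lra.
- move=> n; rewrite zS; have E (x y v : H) : x + y + v - x - y = v by vector_identity.
  by rewrite E normrZ ger0_norm//; case/andP: (lam01 n) => /ltW.
- move=> n k ln; have [_ s0 _ _] := slack_terms k.
  have l32 : 1 <= lam n <= 3 / 2.
    by rewrite ln /=; case/andP: (lam01 n) => _ /ltW; rewrite k32.
  apply: le_trans (drift_contraction_at_zero k gb l32) _.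
  rewrite (rho1 n) (rho1 k) (sigma1 n) lerD2l ler_pM2l; last by rewrite ltr0n.
  move: s0; rewrite sigma1; move: (dot _ _) (dot _ _) (dot _ _).
  by move: (_ - D n / 2) (_ - D k / 2) => *; lra.
- apply: bounded_sums_le (bounded_sumsZ (ler0n R 2) sharp_slack_summable) => n.
  have [l0 s0 r0 t0] := slack_terms n; rewrite mulrCA; apply: ler_wpM2l => //.
  move: s0 r0 t0; rewrite q12.
  by move: (dot (rho n) _) ((2 - 2^-1 - lam n) * _) (sigma n) => *; lra.
- apply: bounded_sums_le sharp_slack_summable => n.
  have [l0 s0 r0 t0] := slack_terms n; rewrite -mulrA; apply: ler_wpM2l => //.
  move: s0 r0 t0; rewrite q12 (_ : 2 - 2^-1 = 3 / 2); last by field.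
  by move: (dot (rho n) _) ((3 / 2 - lam n) * _) (sigma n) => *; lra.
- exact: hM.
Qed.

End ForwardPartialInverse.

(** * Convergence *)

Section Relaxation.
Context {R : realType}.

(** With [q = gamma / (2 beta)], the claim is [alpha (2 - q) >= 1], which reads
    [q <= 1/2] for the first entry of the maximum and [(2 q - 1) (1 - q) >= 0] for
    the second one. *)
Lemma relaxation_bound (beta gamma alpha : R) : 0 < beta -> 0 < gamma < 2 * beta ->
  alpha = Num.max (2 / 3) (2 * gamma / (gamma + 2 * beta)) ->
  [/\ 0 < alpha, alpha^-1 <= 2 - gamma / (2 * beta),
      gamma != beta -> alpha^-1 < 2 - gamma / (2 * beta) &
      gamma = beta -> alpha^-1 = 3 / 2].
Proof.
move=> b0 /andP[g0 g2] aE.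
have gb0 : 0 < gamma + 2 * beta by lra.
have a23 : 2 / 3 <= alpha by rewrite aE le_max lexx.
have a2 : 2 * gamma / (gamma + 2 * beta) <= alpha by rewrite aE le_max lexx orbT.
have a0 : 0 < alpha by lra.
set q := gamma / (2 * beta).
have qE : q * (2 * beta) = gamma by rewrite /q mulfVK// gt_eqF//; lra.
have q1 : q < 1 by rewrite /q ltr_pdivrMr; lra.
have q0 : 0 < q by apply: divr_gt0; lra.
(* The two entries of the maximum exchange their roles at gamma = beta, that
   is at q = 1/2. *)
have a2q : 2 * q / (q + 1) <= alpha.
  rewrite (_ : 2 * q / (q + 1) = 2 * gamma / (gamma + 2 * beta))//.
  by rewrite /q; field; rewrite !gt_eqF//; lra.
have [h1 h2] : alpha * 3 >= 2 /\ alpha * (q + 1) >= 2 * q.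
  by split; [lra|rewrite -ler_pdivrMr//; lra].
have prod_ge : 1 <= alpha * (2 - q).
  have [q12|q12] := lerP q (1 / 2); first by nra.
  suff : 0 <= (q + 1) * (alpha * (2 - q) - 1).
    by rewrite pmulr_rge0 ?subr_ge0//; lra.
  have : (2 * q) * (2 - q) <= alpha * (q + 1) * (2 - q) by rewrite ler_wpM2r//; lra.
  have : 0 <= (2 * q - 1) * (1 - q) by apply: mulr_ge0; lra.
  by lra.
have prod_gt : gamma != beta -> 1 < alpha * (2 - q).
  move=> gb; have q12 : q != 1 / 2.
    by apply: contraNneq gb => qe; rewrite -qE qe; apply/eqP; field.
  have [q12'|q12'] := ltrP q (1 / 2); first by nra.
  have {}q12 : 1 / 2 < q by rewrite lt_neqAle eq_sym q12.
  suff : 0 < (q + 1) * (alpha * (2 - q) - 1).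
    by rewrite pmulr_rgt0 ?subr_gt0//; lra.
  have : (2 * q) * (2 - q) <= alpha * (q + 1) * (2 - q) by rewrite ler_wpM2r//; lra.
  have : 0 < (2 * q - 1) * (1 - q) by apply: mulr_gt0; lra.
  by lra.
split => //.
- by rewrite -[leLHS]mul1r ler_pdivrMr// mulrC.
- by move=> /prod_gt gt; rewrite -[ltLHS]mul1r ltr_pdivrMr// mulrC.
- move=> gb; rewrite aE gb; have -> : 2 * beta / (beta + 2 * beta) = 2 / 3 :> R.
    by field; rewrite gt_eqF//; lra.
  by rewrite maxxx; field.
Qed.

End Relaxation.

Theorem proposition6p9 (R : realType) (H : hilbertType R) (V : set H)
    (hV : closed_subspace V)
    (f : H -> \bar R) (hf : Gamma0 f)
    (beta : R) (hbeta : 0 < beta)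
    (g : H -> R) (dg : forall x, differentiable g x)
    (cg : convex_function setT g)
    (lg : (beta^-1).-lipschitz (gradient g))
    (gamma : R) (hgamma : 0 < gamma < 2 * beta)
    (alpha : R)
    (halpha : alpha = Num.max (2 / 3) (2 * gamma / (gamma + 2 * beta)))
    (lambda : nat -> R) (hlambda : forall n, 0 < lambda n < 1 / alpha)
    (a b : nat -> H)
    (hdiv : (\sum_(0 <= n <oo)
               (lambda n * (1 - alpha * lambda n))%:E = +oo)%E)
    (hsum : (\sum_(0 <= n <oo)
               (lambda n * (`|a n| + `|b n|))%:E < +oo)%E)
    (hzer : zer (op_add (op_add (subdifferential f)
                                (fun x => [set gradient g x]))
                        (normal_cone V)) !=set0)
    (z0 : H) (x y s p z : nat -> H)
    (hz0 : z 0%N = z0)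
    (hx : forall n, x n = projection V (z n))
    (hy : forall n, y n = gamma^-1 *: (x n - z n))
    (hs : forall n, s n =
       x n - gamma *: projection V (gradient g (x n) + a n) + gamma *: y n)
    (hp : forall n, p n = prox (fun t => (gamma%:E * f t)%E) (s n) + b n)
    (hz : forall n, z n.+1 = z n + lambda n *: (p n - x n)) :
  (forall n, V (x n)) /\
  (forall n, orthogonal_complement V (y n)) /\
  exists xbar ybar : H,
    argmin_over V (fun t => (f t + (g t)%:E)%E) xbar /\
    (orthogonal_complement V `&`
       [set u + projection V (gradient g xbar)
         | u in subdifferential f xbar]) ybar /\
    (weakly_cvg x xbar /\ weakly_cvg y ybar) /\
    (x n.+1 - x n @[n --> \oo] --> (0 : H) /\
     y n.+1 - y n @[n --> \oo] --> (0 : H)) /\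
    (\sum_(0 <= n <oo)
       (lambda n *
        `|projection V (gradient g (x n) - gradient g xbar)| ^+ 2)%:E
     < +oo)%E.
Proof.
have [gamma0 gamma2] := andP hgamma.
have [alpha0 kappa_le kappa_lt kappa_eq] := relaxation_bound hbeta hgamma halpha.
set kappa := alpha^-1 in kappa_le kappa_lt kappa_eq.
have kappa0 : 0 < kappa by rewrite invr_gt0.
have lam01 n : 0 < lambda n < kappa by have := hlambda n; rewrite div1r.
have orthP n : orthogonal_complement V (y n).
  move=> v Vv; rewrite inner_dotE hy hx dotZr dotDr dotNr.
  by rewrite (dot_projection hV)// subrr mulr0.
split; first by move=> n; rewrite hx; exact: projection_in.
split => //.
have lip u v : dot (gradient g u - gradient g v) (gradient g u - gradient g v)
    <= (beta^-1) ^+ 2 * dot (u - v) (u - v).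
  rewrite !dot_norm -exprMn ler_pXn2r ?nnegrE//.
    exact: (lg (u, v)).
  by rewrite mulr_ge0// invr_ge0 ltW.
have coco (u v : H) : g v + dot (gradient g v) (u - v) + beta / 2 *
    dot (gradient g u - gradient g v) (gradient g u - gradient g v) <= g u.
  have bV0 : 0 < beta^-1 by rewrite invr_gt0.
  by have := cocoercive_gradient dg cg u v bV0 lip; rewrite invrK.
have [x0 [w [u0 x0u0 [_ -> <-]] [v [Vx0 Vv] uv0]]] := hzer.
set U := residual V f g gamma.
have cocoU := residual_cocoercive hV hf hbeta gamma0 x0u0 coco kappa_le.
have fixU : exists c, U c = 0.
  exists (x0 - gamma *: (u0 + projection V (gradient g x0))).
  apply: (residual_eq0 hV hf gamma0 x0u0) => // t Vt.
  have := congr1 (dot t) uv0; rewrite dotDr dot0r => <-.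
  by rewrite [dot t v]Vv// addr0.
pose err n := prox (fun t => (gamma%:E * f t)%E) (s n) + b n
  - prox (fun t => (gamma%:E * f t)%E) (forward_step V g gamma (z n)).
have zS n : z n.+1 = z n + lambda n *: U (z n) + lambda n *: err n.
  rewrite hz hp hx /U /residual /err.
  move: (prox _ _) (prox _ _) (projection V (z n)) => q q' t.
  by rewrite -[RHS]addrA -scalerDr; congr (_ + _ *: _); vector_identity.
have err_le n : `|err n| <= (gamma + 1) * (`|a n| + `|b n|).
  have -> : err n = (prox (fun t => (gamma%:E * f t)%E) (s n)
      - prox (fun t => (gamma%:E * f t)%E) (forward_step V g gamma (z n))) + b n.
    by rewrite /err addrAC.
  apply: le_trans (ler_normD _ _) _.
  have sE : s n - forward_step V g gamma (z n) = - (gamma *: projection V (a n)).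
    rewrite hs hy hx /forward_step (projectionD hV) scalerA mulfV ?gt_eqF// scale1r.
    move: (projection V (z n)) (projection V (a n))
      (projection V (gradient g (projection V (z n)))) => r t q.
    by vector_identity.
  have h1 := prox_nonexpansive hf gamma0 x0u0 (s n) (forward_step V g gamma (z n)).
  rewrite sE normrN normrZ gtr0_norm// in h1.
  have h2 := ler_wpM2l (ltW gamma0) (projection_norm_le hV (a n)).
  have h3 : 0 <= gamma * `|b n| by rewrite mulr_ge0// ltW.
  have h4 := normr_ge0 (a n).
  rewrite mulrDl mul1r mulrDr; apply: (@le_trans _ _ (gamma * `|a n| + `|b n|)).
    by rewrite lerD2r; exact: le_trans h1 h2.
  by rewrite -addrA lerD2l; rewrite addrA lerDr addr_ge0.
have err_sum : bounded_sums (fun n => lambda n * `|err n|).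
  have ab0 n : 0 <= lambda n * (`|a n| + `|b n|).
    by case/andP: (lam01 n) => /ltW l0 _; rewrite mulr_ge0// addr_ge0.
  have hs' := lty_bounded_sums ab0 hsum.
  have g10 : 0 <= gamma + 1 by rewrite addr_ge0// ltW.
  apply: bounded_sums_le (bounded_sumsZ g10 hs') => n.
  by case/andP: (lam01 n) => /ltW l0 _; rewrite mulrCA ler_wpM2l.
have lam_div : ~ bounded_sums (fun n => lambda n * (kappa - lambda n)).
  move=> bs; have lE n : alpha * (lambda n * (kappa - lambda n)) =
      lambda n * (1 - alpha * lambda n).
    by rewrite mulrCA mulrBr mulfV// gt_eqF.
  have bs' : bounded_sums (fun n => lambda n * (1 - alpha * lambda n)).
    by apply: bounded_sums_le (bounded_sumsZ (ltW alpha0) bs) => n; rewrite lE.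
  suff ge0 n : 0 <= lambda n * (1 - alpha * lambda n).
    by have := bounded_sums_lty ge0 bs'; rewrite hdiv ltxx.
  rewrite -lE; case/andP: (lam01 n) => /ltW l0 /ltW lk.
  by rewrite mulr_ge0 ?(ltW alpha0)// mulr_ge0// subr_ge0.
have [c Uc zc] := iteration_weak_cvg kappa0 cocoU lam01 zS err_sum fixU lam_div.
have step0 := iteration_step_cvg0 kappa0 cocoU lam01 zS err_sum fixU lam_div.
have drift_sum : bounded_sums (fun n =>
    lambda n * dot (drift V g gamma c (z n)) (drift V g gamma c (z n))).
  have [gb|gb] := eqVneq gamma beta.
    apply: (drift_summable_of_equal_steps hV hf hbeta gamma0 x0u0 coco kappa0
      kappa_le lam01 zS) => //.
    exact: kappa_eq.
  apply: (drift_summable_of_margin hV hf hbeta gamma0 x0u0 coco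
    kappa_le lam01 zS) => //.
  exact: kappa_lt.
exists (projection V c), (gamma^-1 *: (projection V c - c)).
have sub := residual0_subdifferential hf gamma0 x0u0 Uc.
set xb := projection V c in sub *.
have Vxb : V xb by exact: projection_in.
have yb_orth v1 : V v1 -> dot v1 (gamma^-1 *: (xb - c)) = 0.
  by move=> Vv1; rewrite dotZr dotDr dotNr (dot_projection hV)// subrr mulr0.
split; [|split; [|split; [|split]]].
- split => // t Vt.
  have := sub t; rewrite inner_dotE dotDr dotNr yb_orth; last exact: subspaceB.
  have Vtx : V (t - xb) by exact: subspaceB.
  rewrite (dot_projection hV _ Vtx) add0r => ht.
  have hg := convex_gradient_ineq dg cg xb t.
  have fx := subdifferential_fin_num hf sub.
  have [ft|] := boolP (f t \is a fin_num); last first.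
    rewrite (fin_numP_Gamma0 hf) -leNgt leye_eq => /eqP ->.
    by rewrite addye//; exact: leey.
  move: ht; rewrite -(fineK fx) -(fineK ft) -!EFinD !lee_fin.
  move: hg; rewrite (dotC (t - xb)); move: (dot _ _) (fine _) (fine _) => *; lra.
- split; first exact: yb_orth.
  exists (gamma^-1 *: (xb - c) - projection V (gradient g xb)) => //.
  by rewrite subrK.
- split=> t; rewrite inner_dotE.
    under eq_fun do rewrite inner_dotE hx (dot_projectionC hV).
    by rewrite (dot_projectionC hV); exact: zc.
  under eq_fun do rewrite inner_dotE hy hx dotZl dotDl dotNl (dot_projectionC hV).
  rewrite dotZl dotDl dotNl (dot_projectionC hV).
  by apply: cvgMr; apply: cvgB; exact: zc.
- have Psmall n : `|projection V (z n.+1 - z n)| <= `|z n.+1 - z n|.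
    exact: projection_norm_le.
  split; apply: norm_cvg0.
    apply: (@squeeze_cvgr _ _ _ _ (fun=> 0) (fun n => `|z n.+1 - z n|)) => //.
      by apply: nearW => n; rewrite normr_ge0 /= !hx -(projectionB hV).
    exact: cvg_cst.
  apply: (@squeeze_cvgr _ _ _ _ (fun=> 0) 
    (fun n => gamma^-1 * (`|z n.+1 - z n| + `|z n.+1 - z n|))) => //.
  + apply: nearW => n; rewrite normr_ge0 /=.
    have -> : y n.+1 - y n = gamma^-1 *: (projection V (z n.+1 - z n) - (z n.+1 - z n)).
      rewrite !hy !hx (projectionB hV); move: (projection _ _) (projection _ _) => q t.
      by vector_identity.
    rewrite normrZ gtr0_norm ?invr_gt0// ler_pM2l ?invr_gt0//.
    by apply: le_trans (ler_normB _ _) _; rewrite lerD2r.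
  + exact: cvg_cst.
  + rewrite -[X in _ --> X](mulr0 gamma^-1) -[X in gamma^-1 * X](addr0 0).
    by apply: cvgMr; exact: cvgD.
- apply: bounded_sums_lty => [n|].
    by case/andP: (lam01 n) => /ltW l0 _; rewrite mulr_ge0// exprn_ge0.
  have gV0 : 0 <= gamma^-1 ^+ 2 by rewrite exprn_ge0// invr_ge0 ltW.
  apply: bounded_sums_le (bounded_sumsZ gV0 drift_sum) => n.
  set e := projection V (gradient g (x n) - gradient g xb).
  suff -> : gamma^-1 ^+ 2 * (lambda n * dot (drift V g gamma c (z n))
      (drift V g gamma c (z n))) = lambda n * dot e e by rewrite dot_norm.
  rewrite /e hx (projectionB hV) /drift -/xb dotZl dotZr.
  by move: (dot _ _) => q; field; rewrite gt_eqF.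
Qed.
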